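(* Let $G=(V,E)$ be a planar graph with a fixed planar embedding and edge length $l:E\to\mathbb{R}^{+}$, and let $T$ be the set of geodesic pairs of $G$. Then there exists an embedding $g:V\to L_1$ such that $\|g(u)-g(v)\|\le d_G(u,v)$ for all $(u,v)\in E$ and $\|g(u)-g(v)\|\ge d_G(u,v)/21$ for all $(u,v)\in T$.
   Context: $d_G$ is the shortest-path metric of $G$ with respect to $l$. A pair of vertices $(u,v)$ is a geodesic pair if there is a face $f$ of $G$ whose boundary cycle contains both $u$ and $v$ and some shortest $u$–$v$ path in $G$ uses only edges of that boundary cycle. An embedding into $L_1$ is a map into $\mathbb{R}^k$ for some $k$, with $\|\cdot\|$ the $\ell_1$ norm. *)

(* Defs.v *)
From HB Require Import structures.
From mathcomp Require Import all_boot all_order all_algebra.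
From mathcomp Require Import boolp classical_sets reals.

Set Implicit Arguments.
Unset Strict Implicit.
Unset Printing Implicit Defensive.

Import Order.TTheory GRing.Theory Num.Theory.

Local Open Scope ring_scope.

Record sgraph := SGraph {
  vertex :> finType;
  adj : rel vertex;
  adj_sym : symmetric adj;
  adj_irrefl : irreflexive adj
}.

(* A dart is an edge with a direction: (u, v) leaves u and enters v. *)
Definition dart (G : sgraph) : finType := {d : G * G | adj d.1 d.2}.

Section Darts.
Variable G : sgraph.

Definition dart_src (d : dart G) : G := (val d).1.
Definition dart_tgt (d : dart G) : G := (val d).2.

Lemma dart_rev_subproof (d : dart G) : adj (dart_tgt d) (dart_src d).
Proof. by rewrite adj_sym (valP d). Qed.

Definition dart_rev (d : dart G) : dart G :=
  exist _ (dart_tgt d, dart_src d) (dart_rev_subproof d).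

Definition next_on_face (rot : dart G -> dart G) (d : dart G) : dart G :=
  rot (dart_rev d).

(* Euler's formula V - E + F = 2C, with V, E, F the numbers of orbits of rot,
   dart_rev and next_on_face, #|dart G| = 2E, and C the number of components.
   Isolated vertices carry no dart and are counted nowhere. For a disconnected
   graph each component is drawn on its own sphere, so the summed genus is 0
   iff every component is planar. *)
Definition euler_planar (rot : dart G -> dart G) : Prop :=
  (fcard rot predT + fcard dart_rev predT + fcard (next_on_face rot) predT =
   #|dart G| + 2 * n_comp (relU (frel rot) (frel dart_rev)) predT)%N.

End Darts.

(* A planar embedding, up to homeomorphism of the sphere, is a rotation system
   of genus 0: rot d is the dart following d in the cyclic order of the darts
   around the vertex that d leaves. *)
Record planar_embedding (G : sgraph) := PlanarEmbedding {
  rot : dart G -> dart G;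
  rot_inj : injective rot;
  rot_orbit : forall d d' : dart G,
    fconnect rot d d' = (dart_src d == dart_src d');
  rot_planar : euler_planar rot
}.

Section Faces.
Variables (G : sgraph) (M : planar_embedding G).

(* The boundary of the face lying beside the dart f, as a closed walk. Every
   face of a nonempty map arises this way, from each dart of its boundary. *)
Definition face_boundary (f : dart G) : seq (dart G) :=
  orbit (next_on_face (rot M)) f.

Definition vertex_on_face (f : dart G) (u : G) : bool :=
  u \in [seq dart_src d | d <- face_boundary f].

Definition edge_on_face (f : dart G) (e : G * G) : bool :=
  let b := [seq val d | d <- face_boundary f] in
  (e \in b) || ((e.2, e.1) \in b).

End Faces.

Section Metric.
Variables (R : realType) (G : sgraph) (l : G -> G -> R).

(* The walk u :: p, given as in path.v by its first vertex and the rest. *)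
Definition walk (u v : G) (p : seq G) : bool :=
  path (@adj G) u p && (last u p == v).

Definition walk_edges (u : G) (p : seq G) : seq (G * G) := zip (u :: p) p.

Definition walk_length (u : G) (p : seq G) : R :=
  \sum_(e <- walk_edges u p) l e.1 e.2.

(* Equal to 0, by the convention for inf, when v is not reachable from u. *)
Definition graph_dist (u v : G) : R :=
  inf [set x : R | exists2 p : seq G, walk u v p & x = walk_length u p]%classic.

Definition shortest_path (u v : G) (p : seq G) : Prop :=
  walk u v p /\ walk_length u p = graph_dist u v.

Definition geodesic_pair (M : planar_embedding G) (u v : G) : Prop :=
  exists f : dart G,
    [/\ vertex_on_face M f u, vertex_on_face M f v &
        exists2 p : seq G, shortest_path u v p &
                           all (edge_on_face M f) (walk_edges u p)].

End Metric.

Definition l1_norm (R : realType) (k : nat) (x : 'rV[R]_k) : R :=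
  \sum_(i < k) `|x ord0 i|.

(* Main.v *)
Require Import Defs.
From mathcomp Require Import all_boot all_order all_algebra fingroup perm.
From mathcomp Require Import boolp reals ring lra zify.

Set Implicit Arguments.
Unset Strict Implicit.
Unset Printing Implicit Defensive.

Import Order.TTheory GRing.Theory Num.Theory.
Import Defs.

Local Open Scope ring_scope.

(** The embedding is a nonnegative combination of cut metrics.

    Let psi be obtained from the face permutation by cutting every face
    boundary walk at its repeated vertices, so that each psi-orbit is a simple
    closed walk. Choose break points on each orbit and draw the chords between
    consecutive break points. The graph stays planar, and by Seymour's theorem
    (a planar graph has a cut packing that realises the distance along every
    edge at once) there is a combination of bonds of G that does not expand
    the edges of G and is exact on all chords. Seymour's theorem
    is proved through Farkas' lemma: a dual solution is a conservative weighting
    of the dual graph, and such a weighting pairs nonnegatively with every length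
    function dominated on cuts. That faces detect cuts is a rank computation
    over F_2 from Euler's formula.

    On a single orbit six choices of break points suffice to keep at least
    half of the length of every geodesic arc in total: maximal geodesic arcs
    taken greedily, arcs around their common end points that are as balanced
    as possible (odd and even ones separately), and three more choices for the
    arcs through the base point. Since a bond crosses a face at most twice, and
    within one psi-orbit, the pieces of a geodesic lying in different orbits of
    a face add up. Averaging the six packings gives the constant 12. *)

(** * Farkas lemma *)

Section Farkas.
Variables (R : realFieldType) (E I : finType).
Implicit Types (a : I -> E -> R) (d w x : E -> R).

Definition dot w x : R := \sum_e w e * x e.

Lemma dotBr w x z c : dot w (fun e => x e - c * z e) = dot w x - c * dot w z.
Proof.
rewrite /dot mulr_sumr -sumrB; apply: eq_bigr => e _; ring.
Qed.

Lemma dotBl w x z c : dot (fun e => x e - c * z e) w = dot x w - c * dot z w.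
Proof.
rewrite /dot mulr_sumr -sumrB; apply: eq_bigr => e _; ring.
Qed.

(** Induction on the generators. If [d] fails the test for [s] alone, a witness [x0] is nonnegative
    on [s] and negative on [d], hence negative on [a j]; projecting along [a j] onto the kernel of
    [x0] removes one generator. *)
Lemma farkas_seq (s : seq I) : uniq s -> forall a d,
  (forall w, (forall i, i \in s -> 0 <= dot w (a i)) -> 0 <= dot w d) ->
  exists2 y : I -> R, forall i, 0 <= y i &
    forall e, d e = \sum_(i <- s) y i * a i e.
Proof.
elim: s => [_|j s IH /= /andP[js us]] a d H.
  exists (fun=> 0) => // e; rewrite big_nil.
  (* This test vector gives [- d e * d e >= 0], so every coordinate of [d] vanishes. *)
  have /(_ (fun f => if f == e then - d f else 0)) : forall w, 0 <= dot w d by move=> w; apply: H.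
  rewrite /dot (bigD1 e) //= eqxx big1 => [|f /negPf ->]; last by rewrite mul0r.
  by move=> ?; apply/eqP; rewrite -sqrf_eq0 eq_le sqr_ge0 andbT expr2; lra.
have [H0|/existsNP[x0 /not_implyP[x0s /negP]]] := pselect
  (forall w, (forall i, i \in s -> 0 <= dot w (a i)) -> 0 <= dot w d).
  have [y y0 yd] := IH us a d H0.
  exists (fun i => if i == j then 0 else y i) => [i|e]; first by case: ifP.
  rewrite big_cons eqxx mul0r add0r yd; apply: eq_big_seq => i si.
  by case: eqP => // ij; rewrite -ij si in js.
rewrite -ltNge => x0d.
have x0j : dot x0 (a j) < 0.
  rewrite ltNge; apply/negP => aj; suff : 0 <= dot x0 d by rewrite leNgt x0d.
  by apply: H => i; rewrite in_cons => /predU1P[->//|/x0s].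
set t := dot x0 (a j) in x0j.
have t0 : t != 0 by lra.
have tV : t^-1 <= 0 by rewrite invr_le0 ltW.
have [|y y0 yd] := IH us (fun i e => a i e - (dot x0 (a i) / t) * a j e)
   (fun e => d e - (dot x0 d / t) * a j e).
  move=> w ws.
  (* The corrected test vector vanishes on [a j], and its pairings with the original vectors are
     those of [w] with the projected ones. *)
  have : 0 <= dot (fun e => w e - (dot w (a j) / t) * x0 e) d.
    apply: H => i; rewrite in_cons dotBl => /predU1P[->|/ws].
      by rewrite -/t divfK // subrr.
    by rewrite dotBr => h; apply: (le_trans h); rewrite le_eqVlt; apply/orP; left; apply/eqP; field.
  by rewrite dotBl dotBr => h; apply: (le_trans h); rewrite le_eqVlt; apply/orP; left; apply/eqP; field.
(* The coefficient of [a j] collects the projection terms; it is nonnegative because [t] and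
   [dot x0 d] are negative while [x0] is nonnegative on [s]. *)
exists (fun i => if i == j then dot x0 d / t - (\sum_(i <- s) y i * dot x0 (a i)) / t else y i).
  move=> i; case: ifP => // _.
  have : 0 <= \sum_(k <- s) y k * dot x0 (a k).
    by rewrite big_seq; apply: sumr_ge0 => k ks; rewrite mulr_ge0 // x0s.
  nra.
move=> e; rewrite big_cons eqxx.
have yde : d e - dot x0 d / t * a j e = \sum_(i <- s) y i * a i e -
    \sum_(i <- s) y i * (dot x0 (a i) / t * a j e).
  by rewrite yd -sumrB; apply: eq_bigr => i _; ring.
have -> : d e = (d e - dot x0 d / t * a j e) + dot x0 d / t * a j e by ring.
rewrite yde mulrBl.
have -> : \sum_(i <- s) (if i == j then dot x0 d / t - (\sum_(i0 <- s) y i0 * dot x0 (a i0)) / t else y i) * a i e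
   = \sum_(i <- s) y i * a i e.
  by apply: eq_big_seq => i si; case: eqP => // ij; rewrite -ij si in js.
have -> : \sum_(i <- s) y i * (dot x0 (a i) / t * a j e) = (\sum_(i <- s) y i * dot x0 (a i)) / t * a j e.
  by rewrite !mulr_suml; apply: eq_bigr => i _; ring.
ring.
Qed.

Lemma farkas a d :
  (forall w, (forall i, 0 <= dot w (a i)) -> 0 <= dot w d) ->
  exists2 y : I -> R, forall i, 0 <= y i & forall e, d e = \sum_i y i * a i e.
Proof.
move=> H; have [|y y0 yd] := farkas_seq (enum_uniq I) (a := a) (d := d).
  by move=> w ws; apply: H => i; apply: ws; rewrite mem_enum.
by exists y => // e; rewrite yd big_enum.
Qed.

End Farkas.

(** * Joins and even sets in multigraphs *)

Section SymDiff.
Variable E : finType.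
Implicit Types A B C : {set E}.

Definition sdiff A B : {set E} := [set e | (e \in A) (+) (e \in B)].

Lemma big_sdiff A B (F : E -> bool) :
  \big[addb/false]_(e in sdiff A B) F e =
  \big[addb/false]_(e in A) F e (+) \big[addb/false]_(e in B) F e.
Proof.
rewrite big_mkcond [X in X (+) _]big_mkcond [X in _ (+) X]big_mkcond -big_split.
by apply: eq_bigr => e _; rewrite inE; case: (e \in A); case: (e \in B); case: (F e).
Qed.

Lemma sdiff_disjoint A B : [disjoint A & B] -> sdiff A B = A :|: B.
Proof.
move=> AB; apply/setP => e; rewrite !inE.
by have := @disjointFr _ _ _ e AB; case: (e \in A) => // ->.
Qed.

Lemma sdiff_sub A B : B \subset A -> sdiff A B = A :\: B.
Proof.
move=> BA; apply/setP => e; rewrite !inE.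
by have := subsetP BA e; case: (e \in B) => [->//|]; rewrite addbF.
Qed.

Lemma sum_sdiff (R : realFieldType) (w : E -> R) A B :
  \sum_(e in sdiff A B) w e =
  \sum_(e in A) w e + \sum_(e in B) w e - (\sum_(e in A :&: B) w e) *+ 2.
Proof.
rewrite -sumrMnl big_mkcond.
rewrite [X in X + _ - _]big_mkcond [X in _ + X - _]big_mkcond [X in _ - X]big_mkcond.
rewrite -big_split -sumrB /=; apply: eq_bigr => e _; rewrite !inE.
by case: (e \in A); case: (e \in B) => /=; ring.
Qed.

End SymDiff.

Section Joins.
Variables (V E : finType) (s t : E -> V).
Implicit Types (J C K : {set E}) (x y z v : V) (e f : E).

(** Exclusive or leaves a loop without ends. Thus [bdry] is degree parity, the even sets form the
    cycle space over F_2, and [is_join] describes T-joins with T = {x, y}, which are even sets when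
    x = y. *)
Definition ends e v := (s e == v) (+) (t e == v).
Definition bdry J v := \big[addb/false]_(e in J) ends e v.
Definition is_join x y J := [forall v, bdry J v == (v == x) (+) (v == y)].
Definition even_set J := [forall v, ~~ bdry J v].

Lemma is_joinP x y J : reflect (forall v, bdry J v = (v == x) (+) (v == y)) (is_join x y J).
Proof. exact: 'forall_eqP. Qed.

Lemma evenP J : reflect (forall v, bdry J v = false) (even_set J).
Proof. by apply: (iffP forallP) => H v; [apply/negbTE/H|rewrite H]. Qed.

Lemma even_join x J : even_set J = is_join x x J.
Proof. by apply/evenP/is_joinP => H v; rewrite H addbb. Qed.

Lemma bdry_sdiff J K v : bdry (sdiff J K) v = bdry J v (+) bdry K v.
Proof. exact: big_sdiff. Qed.

Lemma is_join_sym x y J : is_join x y J -> is_join y x J.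
Proof. by move/is_joinP => H; apply/is_joinP => v; rewrite H addbC. Qed.

Lemma is_join_sdiff x y z J K : is_join x y J -> is_join y z K -> is_join x z (sdiff J K).
Proof.
move=> /is_joinP HJ /is_joinP HK; apply/is_joinP => v; rewrite bdry_sdiff HJ HK.
by rewrite -addbA; congr addb; rewrite addbA addbb addFb.
Qed.

Lemma even_sdiff J K : even_set J -> even_set K -> even_set (sdiff J K).
Proof. by move=> /evenP HJ /evenP HK; apply/evenP => v; rewrite bdry_sdiff HJ HK. Qed.

Lemma even0 : even_set set0.
Proof. by apply/evenP => v; rewrite /bdry big_set0. Qed.

Lemma bdry_sub J K v : K \subset J -> bdry (J :\: K) v = bdry J v (+) bdry K v.
Proof. by move=> /sdiff_sub <-; rewrite bdry_sdiff. Qed.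

Lemma even_setD J K : K \subset J -> even_set J -> even_set K -> even_set (J :\: K).
Proof. by move=> /sdiff_sub <-; apply: even_sdiff. Qed.

Lemma bdry1 e v : bdry [set e] v = ends e v.
Proof. by rewrite /bdry big_set1. Qed.

Lemma is_join1 e : is_join (s e) (t e) [set e].
Proof. by apply/is_joinP => v; rewrite bdry1 /ends !(eq_sym v). Qed.

Lemma ends_joinE e v : ends e v -> exists u, [/\ is_join v u [set e], u != v &
  (s e = v /\ t e = u) \/ (s e = u /\ t e = v)].
Proof.
rewrite /ends; have [<-|nsv] /= := eqVneq (s e) v.
  by move=> tv; exists (t e); split => //; [exact: is_join1|left].
move/eqP => tv; exists (s e); split => //; last by right.
by apply: is_join_sym; rewrite -tv; exact: is_join1.
Qed.

Lemma ends_join e v : ends e v -> exists2 u, is_join v u [set e] & u != v.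
Proof. by case/ends_joinE => u [H1 H2 _]; exists u. Qed.

Lemma join_ends e v u : is_join v u [set e] -> u != v -> forall x, ends e x = (x == v) || (x == u).
Proof.
move=> /is_joinP H uv x; rewrite -bdry1 H.
by have [->|] := eqVneq x v => //=; rewrite eq_sym (negPf uv).
Qed.

Lemma bdry_ends J v : bdry J v -> exists2 e, e \in J & ends e v.
Proof.
move=> b; apply/exists_inP; move: b; apply: contraLR.
rewrite negb_exists_in => /forall_inP H; rewrite /bdry big1 // => e eJ.
exact/negbTE/H.
Qed.

(** Walk from [x] through edges of [J], deleting each one used, and stop on first reaching [v]. *)
Lemma join_one_end v J x : x != v -> is_join x v J ->
  exists J' e, [/\ J' \subset J, is_join x v J', e \in J', ends e v &
                forall f, f \in J' -> ends f v -> f = e].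
Proof.
have [n] := ubnP #|J|; elim: n J x => // n IH J x leJ xv Jxv.
have [|a aJ ax] := @bdry_ends J x.
  by rewrite (is_joinP _ _ _ Jxv) eqxx (negPf xv).
have [z axz zx] := ends_join ax.
have Jzv : is_join z v (J :\ a).
  by rewrite -sdiff_sub ?sub1set //; apply: is_join_sym; apply: is_join_sdiff (is_join_sym Jxv) axz.
have [zv|zv] := eqVneq z v.
  exists [set a], a; rewrite sub1set -{1 2}zv; split => //; first by rewrite set11.
    by rewrite (join_ends axz zx) eqxx orbT.
  by move=> f /set1P.
have [|J' [e [sJ' J'zv eJ' ev He]]] := IH _ _ _ zv Jzv.
  by rewrite (cardsD1 a) aJ in leJ.
exists (a |: J'), e.
have dis : [disjoint [set a] & J'].
  by rewrite disjoints1; apply/negP => /(subsetP sJ'); rewrite !inE eqxx.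
split.
- by rewrite subUset sub1set aJ; apply: subset_trans sJ' (subD1set _ _).
- by rewrite -sdiff_disjoint //; apply: is_join_sdiff axz J'zv.
- by rewrite inE eJ' orbT.
- by [].
move=> f /setU1P[->|/He //]; rewrite (join_ends axz zx).
by rewrite eq_sym (negPf xv) eq_sym (negPf zv).
Qed.

(** A component has an even number of odd vertices. The proof walks from [v], deleting edges, until
    it meets another vertex that is odd in [K]. *)
Lemma odd_reach K v : bdry K v ->
  exists x J, [/\ x != v, bdry K x, J \subset K & is_join x v J].
Proof.
have [n] := ubnP #|K|; elim: n K v => // n IH K v leK Kv.
have [a aK av] := bdry_ends Kv.
have [z avz zv] := ends_join av.
have [Kz|Kz] := boolP (bdry K z).
  by exists z, [set a]; rewrite sub1set; split => //; exact: is_join_sym.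
have Ka x : bdry (K :\ a) x = bdry K x (+) ((x == v) || (x == z)).
  by rewrite bdry_sub ?sub1set // bdry1 (join_ends avz zv).
have [||x [J [xz xKa sJ Jxz]]] := IH (K :\ a) z.
- by rewrite (cardsD1 a) aK in leK.
- by rewrite Ka eqxx orbT addbT.
have xv : x != v by apply/eqP => xv; rewrite Ka xv eqxx Kv in xKa.
exists x, (a |: J); split => //.
- by move: xKa; rewrite Ka (negPf xv) (negPf xz) addbF.
- by rewrite subUset sub1set aK; apply: subset_trans sJ (subD1set _ _).
rewrite -sdiff_disjoint; last first.
  by rewrite disjoints1; apply/negP => /(subsetP sJ); rewrite !inE eqxx.
by apply: is_join_sym; apply: is_join_sdiff avz _; apply: is_join_sym.
Qed.

(** With [Y] written as a sum of vertex indicators, each vertex contributes its degree parity in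
    [C]: an even set meets every vertex cut evenly. *)
Lemma even_test C (Y : V -> bool) : even_set C ->
  \big[addb/false]_(e in C) (Y (s e) (+) Y (t e)) = false.
Proof.
move=> /evenP HC.
have pick e : Y (s e) (+) Y (t e) = \big[addb/false]_v (Y v && ends e v).
  have H u : Y u = \big[addb/false]_v (Y v && (u == v)).
    rewrite (bigD1 u) //= eqxx andbT big1 ?addbF // => v /negPf vu.
    by rewrite eq_sym vu andbF.
  by rewrite [in LHS](H (s e)) [in LHS](H (t e)) -big_split; apply: eq_bigr => v _; rewrite /= andb_addr.
under eq_bigr do rewrite pick.
rewrite exchange_big big1 //= => v _.
have := HC v; rewrite /bdry; case: (Y v) => //= _.
by rewrite big1.
Qed.

Definition circuit C :=
  [&& even_set C, C != set0 & [forall C' : {set E}, (C' \subset C) && even_set C' ==> ((C' == set0) || (C' == C))]].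

Lemma circuitP C : reflect [/\ even_set C, C != set0 &
    forall C', C' \subset C -> even_set C' -> C' = set0 \/ C' = C] (circuit C).
Proof.
apply: (iffP and3P) => [[H1 H2 /forallP H3]|[H1 H2 H3]]; split => //.
  move=> C' sC eC; have := H3 C'; rewrite sC eC => /orP[/eqP ->|/eqP ->]; by [left|right].
apply/forallP => C'; apply/implyP => /andP[sC eC].
by have [->|->] := H3 _ sC eC; rewrite eqxx ?orbT.
Qed.

Lemma circuit_sub C : even_set C -> C != set0 -> exists2 C0 : {set E}, C0 \subset C & circuit C0.
Proof.
move=> eC C0.
pose P := [pred D : {set E} | [&& D \subset C, even_set D & D != set0]].
have PC : P C by rewrite /= subxx eC.
case: (arg_minnP (fun D : {set E} => #|D|) PC) => D /and3P[sD eD D0] mD.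
exists D => //; apply/circuitP; split => // D' sD' eD'.
have [->|D'0] := eqVneq D' set0; [by left|right].
apply/eqP; rewrite eqEcard sD' mD //= eD' D'0 (subset_trans sD') //.
Qed.

Lemma even_circuit_ind (P : {set E} -> Prop) : P set0 ->
  (forall C0 C, circuit C0 -> even_set C -> [disjoint C0 & C] -> P C -> P (C0 :|: C)) ->
  forall C, even_set C -> P C.
Proof.
move=> P0 PU C; have [n] := ubnP #|C|; elim: n C => // n IH C leC eC.
have [->//|C0] := eqVneq C set0.
have [D sD cD] := circuit_sub eC C0.
have [eD D0 _] := circuitP _ cD.
have -> : C = D :|: (C :\: D) by rewrite -{1}(setID C D) (setIidPr sD).
have eCD := even_setD sD eC eD.
apply: PU => //; first by rewrite -setI_eq0 setIDA setIC -setIDA setDv setI0.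
apply: IH => //; rewrite cardsD (setIidPr sD).
have : (0 < #|D|)%N by rewrite card_gt0.
by have := subset_leq_card sD; lia.
Qed.

(** Removing [f] leaves a join from the other end of [f] to [v]. A subjoin with a single edge at [v]
    closes up with [f] to an even subset, which is all of [C] by minimality. *)
Lemma circuit_deg2 C f v : circuit C -> f \in C -> ends f v ->
  exists f', [/\ f' \in C, f' != f, ends f' v &
     forall h, h \in C -> ends h v -> h = f \/ h = f'].
Proof.
move=> /circuitP[eC _ mC] fC fv.
have [u fvu uv] := ends_join fv.
have Juv : is_join u v (C :\ f).
  rewrite -sdiff_sub ?sub1set //; apply: is_join_sym.
  by apply: is_join_sdiff fvu; rewrite -even_join.
have [J' [e [sJ' J'uv eJ' ev He]]] := join_one_end uv Juv.
have dis : [disjoint [set f] & J'].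
  by rewrite disjoints1; apply/negP => /(subsetP sJ'); rewrite !inE eqxx.
have CE : f |: J' = C.
  have [||/setP/(_ f)|//] := mC (f |: J').
  - by rewrite subUset sub1set fC; apply: subset_trans sJ' (subD1set _ _).
  - by rewrite (even_join v) -sdiff_disjoint //; apply: is_join_sdiff fvu J'uv.
  - by rewrite !inE eqxx.
exists e; split => //.
- by rewrite -CE inE eJ' orbT.
- by apply/eqP => ef; have := subsetP sJ' _ eJ'; rewrite ef !inE eqxx.
move=> h; rewrite -CE => /setU1P[->|/He hv]; [by left|by move=> /hv; right].
Qed.

(** The edges of [C] whose ends can be joined to [v] inside [C] form a nonempty even subset, hence
    all of [C]. *)
Lemma circuit_connected C f h x v : circuit C -> f \in C -> ends f v ->
  h \in C -> ends h x -> exists2 A : {set E}, A \subset C & is_join x v A.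
Proof.
move=> /circuitP[eC _ mC] fC fv hC hx.
pose reach z := [exists A : {set E}, (A \subset C) && is_join z v A].
have reach_step a y z : a \in C -> is_join y z [set a] -> reach y -> reach z.
  move=> aC ayz /existsP[A /andP[sA Ayv]]; apply/existsP; exists (sdiff [set a] A).
  rewrite (is_join_sdiff (is_join_sym ayz) Ayv) andbT; apply/subsetP => b; rewrite !inE.
  by case: eqP => [->//|_ /=]; move/(subsetP sA).
have reachE a y : a \in C -> ends a y -> reach y = reach (s a).
  move=> aC; rewrite /ends; have [<-//|nsy] /= := eqVneq (s a) y; move/eqP <-.
  by apply/idP/idP; apply: reach_step aC _; [apply: is_join_sym|]; exact: is_join1.
have rv : reach v.
  by apply/existsP; exists set0; rewrite sub0set -even_join even0.
pose D := [set a in C | reach (s a)].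
have [||D0|DC] := mC D.
- by apply/subsetP => a; rewrite inE => /andP[].
- apply/evenP => y; have /evenP/(_ y) := eC; rewrite /bdry.
  have -> : \big[addb/false]_(e in D) ends e y = \big[addb/false]_(e in C) (reach y && ends e y).
    rewrite big_mkcond [RHS]big_mkcond; apply: eq_bigr => a _; rewrite inE.
    case aC: (a \in C) => //=; case: (ends a y) (reachE a y aC) => [/(_ isT) ->|_].
      by case: (reach (s a)).
    by case: (reach (s a)); case: (reach y).
  by case: (reach y) => //= _; rewrite big1.
- by have := in_set0 f; rewrite -D0 inE fC -(reachE f v fC fv) rv.
have : reach x by rewrite (reachE h x hC hx); move: hC; rewrite -{1}DC inE => /andP[].
by case/existsP => A /andP[]; exists A.
Qed.

(* The distance is only assumed to satisfy the triangle inequality inside a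
   class of [conn], e.g. inside a connected component. *)
Lemma join_dist (R : realFieldType) (d : V -> V -> R) (conn : V -> V -> Prop) J x y :
  (forall u v, d u v = d v u) ->
  (forall u v, conn u v -> conn v u) ->
  (forall u, conn u u /\ d u u = 0) ->
  (forall u v, 0 <= d u v) ->
  (forall u v z, conn u v -> conn v z -> conn u z /\ d u z <= d u v + d v z) ->
  (forall e, conn (s e) (t e)) ->
  is_join x y J -> conn x y /\ d x y <= \sum_(e in J) d (s e) (t e).
Proof.
move=> dC cC d0 dge dT cE.
have [n] := ubnP #|J|; elim: n J x => // n IH J x leJ Jxy.
have [->|xy] := eqVneq x y.
  by have [? ->] := d0 y; split => //; apply: sumr_ge0.
have [|a aJ ax] := @bdry_ends J x.
  by rewrite (is_joinP _ _ _ Jxy) eqxx (negPf xy).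
have [z [axz zx az]] := ends_joinE ax.
have Jzy : is_join z y (J :\ a).
  by rewrite -sdiff_sub ?sub1set //; apply: is_join_sym; apply: is_join_sdiff (is_join_sym Jxy) axz.
have [|cz dz] := IH _ _ _ Jzy; first by rewrite (cardsD1 a) aJ in leJ.
have [ca da] : conn x z /\ d x z = d (s a) (t a).
  by case: az => -[<- <-]; split => //; apply: cC.
have [? le] := dT _ _ _ ca cz; split => //.
by rewrite (big_setD1 a) //= (le_trans le) // da lerD.
Qed.

End Joins.

(** * Conservative weightings *)

Section Conservative.
Variables (R : realFieldType) (V E : finType).
Implicit Types (s t : E -> V) (w d : E -> R) (C D J : {set E}).

Definition wt w C := \sum_(e in C) w e.
Definition conservative s t w := forall C, even_set s t C -> 0 <= wt w C.
(** Seymour's cut condition for nonnegative sums of circuits. *)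
Definition cut_dominated s t d := forall (X : {set V}) e, (s e \in X) != (t e \in X) ->
  d e <= \sum_(f | ((s f \in X) != (t f \in X)) && (f != e)) d f.

Lemma wtU w C D : [disjoint C & D] -> wt w (C :|: D) = wt w C + wt w D.
Proof. by move=> CD; rewrite /wt -bigU //; apply: eq_bigl => e; rewrite !inE. Qed.

Lemma wtD w C D : D \subset C -> wt w (C :\: D) = wt w C - wt w D.
Proof.
move=> DC; rewrite /wt [X in _ = X - _](big_setID D) /= (setIidPr DC); ring.
Qed.

Lemma wt1 w e : wt w [set e] = w e.
Proof. exact: big_set1. Qed.

(** Minimise first the weight over joins with arbitrary end points, then the number of edges; a
    single negative edge shows that the minimum is negative. *)
Lemma minimal_join s t w : conservative s t w -> (exists e, w e < 0) ->
  exists x v J, [/\ is_join s t x v J, wt w J < 0 &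
    forall x' v' J', is_join s t x' v' J' ->
      wt w J <= wt w J' /\ (wt w J' <= wt w J -> (#|J| <= #|J'|)%N)].
Proof.
move=> cw [e we].
pose P := [pred p : (V * V * {set E}) | is_join s t p.1.1 p.1.2 p.2].
pose p0 : V * V * {set E} := (s e, t e, [set e]).
have Pp0 : P p0 by exact: is_join1.
case: (arg_minP (fun p : (V * V * {set E}) => wt w p.2) Pp0) => p1 Pp1 min1.
pose Q := [pred p | P p && (wt w p.2 <= wt w p1.2)].
have Qp1 : Q p1 by apply/andP.
case: (arg_minnP (fun p : (V * V * {set E}) => #|p.2|) Qp1) => -[[x v] J] /andP[/= Pp le1] min2.
exists x, v, J; split => // [|x' v' J' J'P].
  by apply: le_lt_trans le1 _; apply: le_lt_trans (min1 _ Pp0) _; rewrite wt1.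
have le2 := min1 (x', v', J') J'P; rewrite /= in le2.
split; first exact: le_trans le1 le2.
by move=> le3; apply: (min2 (x', v', J')); apply/andP; split => //; exact: le_trans le3 le1.
Qed.

(** The vertex is an end [v] of a lightest join [J], smallest among the lightest, and [e] is its
    only edge there. Dropping or adding one edge at [v] yields another join, which fixes the signs;
    a circuit of weight zero through [v] that avoids [e] would yield a better join or a negative
    even set. *)
Lemma pivot_vertex s t w : conservative s t w ->
  (forall e, s e != t e -> w e != 0) -> (exists e, w e < 0) ->
  exists v e, [/\ ends s t e v, w e < 0,
    forall f, ends s t f v -> f != e -> 0 < w f &
    forall C f, circuit s t C -> wt w C = 0 -> f \in C -> ends s t f v -> e \in C].
Proof.
move=> cw nz ex; have [x [v [J [Jxv wJ minJ]]]] := minimal_join cw ex.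
have xv : x != v.
  apply/eqP => xv; move: Jxv; rewrite xv -even_join => /cw; rewrite leNgt wJ //.
have sub_min J' : J' \subset J -> is_join s t x v J' -> J' = J.
  move=> sJ J'xv; apply/eqP; rewrite eqEcard sJ /=.
  apply: (minJ _ _ _ J'xv).2; rewrite -subr_ge0 -wtD // cw // -sdiff_sub // (even_join _ _ x).
  by apply: is_join_sdiff Jxv _; exact: is_join_sym.
have nloop f u : ends s t f u -> s f != t f.
  by rewrite /ends; apply: contraTneq => ->; rewrite addbb.
have [J' [e [sJ' J'xv eJ ev He]]] := join_one_end xv Jxv.
rewrite (sub_min _ sJ' J'xv) in eJ He => {J' sJ' J'xv}.
have pos f : ends s t f v -> f != e -> 0 < w f.
  move=> fv fe; rewrite lt_neqAle eq_sym nz ?(nloop _ _ fv) //=.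
  have fJ : f \notin J by apply: contra fe => /He/(_ fv) ->.
  have [u fvu uv] := ends_join fv.
  have [+ _] := minJ _ _ _ (is_join_sdiff Jxv fvu).
  rewrite sdiff_disjoint; last by rewrite disjoint_sym disjoints1.
  rewrite wtU; last by rewrite disjoint_sym disjoints1.
  by rewrite wt1; lra.
have we : w e < 0.
  have [u evu uv] := ends_join ev.
  have [_ +] := minJ _ _ _ (is_join_sdiff Jxv evu).
  rewrite sdiff_sub ?sub1set // wtD ?sub1set // wt1 => h.
  rewrite ltNge; apply/negP => we; have : wt w J - w e <= wt w J by rewrite gerBl.
  by move/h; rewrite (cardsD1 e J) eJ add1n ltnn.
exists v, e; split => // C f cC C0 fC fv; apply: contraT => eC.
have [eveC _ _] := circuitP _ _ _ cC.
have fe : f != e by apply: contraNneq eC => <-.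
have JCv : bdry s t (J :\: C) v.
  rewrite /bdry (bigD1 e) /=; last by rewrite inE eC.
  rewrite ev big1 // => h /andP[]; rewrite inE => /andP[_ hJ] he.
  by apply/negbTE; apply: contra he => /(He _ hJ) ->.
have [x' [J2 [x'v JCx' sJ2 J2x'v]]] := odd_reach JCv.
have sJ2J : J2 \subset J by apply: subset_trans sJ2 (subsetDl _ _).
have dJ2 : [disjoint J2 & C].
  by apply/pred0P => h /=; apply/negbTE/negP => /andP[/(subsetP sJ2)]; rewrite inE => /andP[/negPf ->].
(* If [x'] lies on [C], then [C] splits into two joins [A] and [C :\: A] from [x'] to [v]. Each
   closes up with [J2] to an even set, and the two weights sum to twice [wt w J2], which is
   negative. *)
have [[h hC hx']|noC] := pselect (exists2 h, h \in C & ends s t h x').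
  have [A sA Ax'v] := circuit_connected cC fC fv hC hx'.
  have wJ2 : wt w J2 < 0.
    have [//|wJ2] := ltP (wt w J2) 0.
    have Jxx' : is_join s t x x' (J :\: J2).
      by rewrite -sdiff_sub //; apply: is_join_sdiff Jxv _; exact: is_join_sym.
    have [_] := minJ _ _ _ Jxx'; rewrite wtD //= cardsD (setIidPr sJ2J) => l3.
    have : (0 < #|J2|)%N.
      rewrite card_gt0; apply: contraTneq J2x'v => ->; apply/negP => /is_joinP/(_ v).
      by rewrite /bdry big_set0 eqxx eq_sym (negPf x'v).
    have := subset_leq_card sJ2J => l1 l2.
    have l4 : wt w J - wt w J2 <= wt w J by rewrite gerBl.
    by exfalso; move: (l3 l4) l1 l2; clear; lia.
  have dA : [disjoint J2 & A] by apply: disjointWr dJ2.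
  have dB : [disjoint J2 & C :\: A] by apply: disjointWr dJ2; exact: subsetDl.
  have e1 : 0 <= wt w J2 + wt w A.
    rewrite -wtU // cw // (even_join _ _ v) -sdiff_disjoint //.
    by apply: is_join_sdiff Ax'v; exact: is_join_sym.
  have e2 : 0 <= wt w J2 + wt w (C :\: A).
    rewrite -wtU // cw // (even_join _ _ v) -sdiff_disjoint //.
    apply: (is_join_sdiff (is_join_sym J2x'v)); rewrite -sdiff_sub //.
    by apply: is_join_sdiff Ax'v; rewrite -even_join.
  by rewrite wtD // C0 in e2; lra.
(* Otherwise [x'] is odd in [J], so [x' = x] and [J2 = J] is disjoint from [C]; then [J :|: C]
   without [f] is a join lighter than [J] by [w f]. *)
have bC0 : bdry s t (J :&: C) x' = false.
  rewrite /bdry big1 // => h /setIP[_ hC]; apply/negbTE/negP => hx'.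
  by apply: noC; exists h.
have x'x : x' = x.
  move: JCx'; have -> : J :\: C = J :\: (J :&: C) by rewrite setDIr setDv set0U.
  rewrite bdry_sub ?subsetIl // bC0 addbF (is_joinP _ _ _ _ _ Jxv) (negPf x'v) addbF.
  by move/eqP.
rewrite x'x in J2x'v.
have [u fvu uv] := ends_join fv.
have J2C : is_join s t x v (J2 :|: C).
  by rewrite -sdiff_disjoint //; apply: is_join_sdiff J2x'v _; rewrite -even_join.
have [+ _] := minJ _ _ _ (is_join_sdiff J2C fvu).
have fU : [set f] \subset J2 :|: C by rewrite sub1set inE fC orbT.
rewrite sdiff_sub // wtD // wtU // C0 wt1 (sub_min _ sJ2J J2x'v).
have := pos _ fv fe; lra.
Qed.

End Conservative.

(** * Contracting an edge *)

Section Contraction.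
Variables (R : realFieldType) (V E : finType) (s t : E -> V) (f : E).
Hypothesis f_nloop : s f != t f.

Definition merge v := if v == t f then s f else v.

Lemma ends_merge e v : ends (merge \o s) (merge \o t) e v =
  if v == t f then false else
  if v == s f then ends s t e (s f) (+) ends s t e (t f) else ends s t e v.
Proof.
have H u : (merge u == v) = if v == t f then false else
  if v == s f then (u == s f) (+) (u == t f) else u == v.
  rewrite /merge; have [->|vt] := eqVneq v (t f).
    by have [_|/negPf] := eqVneq u (t f); [exact/negbTE|].
  have [->|vs] := eqVneq v (s f).
    have [->|_] := eqVneq u (t f); first by rewrite eqxx eq_sym (negPf f_nloop).
    by rewrite addbF.
  have [->|//] := eqVneq u (t f).
  by rewrite eq_sym (negPf vs) eq_sym (negPf vt).
rewrite /ends /= !H; case: ifP => // _; case: ifP => // _.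
by case: (_ == _); case: (_ == _); case: (_ == _); case: (_ == _).
Qed.

(** Contraction hides odd degrees only at the two ends of [f], where the parities agree; when both
    are odd, toggling [f] repairs them. *)
Lemma even_merge C : even_set (merge \o s) (merge \o t) C ->
  even_set s t C \/ even_set s t (sdiff C [set f]).
Proof.
move=> /evenP H.
have H1 v : v != t f -> v != s f -> bdry s t C v = false.
  move=> vt vs; rewrite -(H v); apply: eq_bigr => e _.
  by rewrite ends_merge (negPf vt) (negPf vs).
have H2 : bdry s t C (s f) = bdry s t C (t f).
  apply/eqP; apply: contraFT (H (s f)) => ne; rewrite /bdry.
  under eq_bigr do rewrite ends_merge (negPf f_nloop) eqxx.
  rewrite big_split /= -/(bdry s t C (s f)) -/(bdry s t C (t f)).
  by move: ne; case: (bdry s t C (s f)); case: (bdry s t C (t f)).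
case b: (bdry s t C (s f)); [right|left]; last first.
  apply/evenP => v; have [->|vt] := eqVneq v (t f); first by rewrite -H2.
  by have [->//|vs] := eqVneq v (s f); exact: H1.
rewrite (even_join _ _ (s f)); apply: (@is_join_sdiff _ _ _ _ _ (t f)); last first.
  by apply: is_join_sym; exact: is_join1.
apply/is_joinP => v; have [->|vt] := eqVneq v (t f).
  by rewrite -H2 b eq_sym (negPf f_nloop).
by have [->|vs] := eqVneq v (s f); [rewrite b|rewrite H1].
Qed.

Lemma conservative_merge (w : E -> R) : w f = 0 -> conservative s t w ->
  conservative (merge \o s) (merge \o t) w.
Proof.
move=> wf cw C /even_merge[/cw //|/cw]; rewrite /wt sum_sdiff big_set1 wf.
rewrite [X in X *+ 2]big1 ?mul0rn ?addr0 ?subr0 // => e /setIP[_ /set1P ->//].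
Qed.

(** Every cut of the contracted graph is a cut of the original one, given by the preimage of [X]. *)
Lemma cut_dominated_merge (d : E -> R) : cut_dominated s t d ->
  cut_dominated (merge \o s) (merge \o t) d.
Proof.
move=> H X e; have := H [set v | merge v \in X] e; rewrite !inE => H' /H' le.
by apply: le_trans le _; rewrite le_eqVlt; apply/orP; left; apply/eqP/eq_bigl => h; rewrite !inE.
Qed.

Lemma nloop_merge : (#|[set e | (merge \o s) e != (merge \o t) e]| < #|[set e | s e != t e]|)%N.
Proof.
apply: proper_card; apply/properP; split.
  by apply/subsetP => e; rewrite !inE /=; apply: contraNneq => ->.
by exists f; rewrite !inE //= /merge eqxx (negPf f_nloop) eqxx.
Qed.

End Contraction.

(** * Pairing conservative weightings with cut-dominated lengths *)

Section Core.
Variables (R : realFieldType) (V E : finType).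
Implicit Types (s t : E -> V) (w d : E -> R) (C J : {set E}).

(** Termination measure for shifting weight at a pivot vertex: it drops as soon as one more even set
    or edge becomes tight. *)
Definition slack_count s t w :=
  (#|[set C | even_set s t C && (wt w C != 0%R)]| + #|[set f | w f != 0%R]|)%N.

Lemma wtB w q c C : wt (fun f => w f - c * q f) C = wt w C - c * wt q C.
Proof. by rewrite /wt mulr_sumr sumrB. Qed.

(* Routing eps units of the negative edge around the star of the pivot vertex;
   eps is chosen maximal, so a new edge or even set becomes tight. *)
Lemma conservative_step s t w d : conservative s t w -> cut_dominated s t d ->
  (forall e, s e != t e -> w e != 0) -> (exists e, w e < 0) ->
  exists w', [/\ conservative s t w', dot w' d <= dot w d &
    (slack_count s t w' < slack_count s t w)%N].
Proof.
move=> cw dd nz ex; have [v [e [ev we pos tight]]] := pivot_vertex cw nz ex.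
(* The shift [w - eps * q] raises the negative edge and lowers the positive ones at [v]. A circuit
   has [q]-weight 2 if it passes through [v] without [e], and 0 otherwise. *)
pose q f : R := if f == e then -1 else (ends s t f v)%:R.
have q_e : q e = -1 by rewrite /q eqxx.
have q_1 f : ends s t f v -> f != e -> q f = 1 by rewrite /q => -> /negPf ->.
have q_0 f : ends s t f v = false -> q f = 0.
  by rewrite /q; have [->|_ ->//] := eqVneq f e; rewrite ev.
have two C f f' : f \in C -> f' \in C -> f' != f ->
    (forall h, h \in C -> ends s t h v -> h = f \/ h = f') -> wt q C = q f + q f'.
  move=> fC f'C ff' H; rewrite /wt (bigD1 f) //= (bigD1 f') /=; last by rewrite f'C.
  rewrite big1 ?addr0 // => h /andP[/andP[hC hf] hf']; apply: q_0.
  by apply/negbTE/negP => /(H h hC) [] eh; rewrite eh eqxx in hf hf'.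
have qC C : circuit s t C -> wt q C = 0 \/ (wt q C = 2 /\ 0 < wt w C).
  move=> cC; have [eC|eC] := boolP (e \in C).
    have [f' [f'C f'e f'v H]] := circuit_deg2 cC eC ev.
    by left; rewrite (two C e f') // q_e q_1 // addNr.
  have [[f fC fv]|no] := pselect (exists2 f, f \in C & ends s t f v).
    have [f' [f'C f'e f'v H]] := circuit_deg2 cC fC fv; right.
    have fe h : h \in C -> h != e by move=> hC; apply: contraNneq eC => <-.
    rewrite (two C f f') // !q_1 ?fe //; split; first by ring.
    have [evC _ _] := circuitP _ _ _ cC.
    rewrite lt_neqAle cw // andbT eq_sym; apply/eqP => C0.
    by rewrite (tight C f) in eC.
  left; rewrite /wt big1 // => f fC; apply: q_0; apply/negbTE/negP => fv.
  by apply: no; exists f.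
(* The bounds on [eps]: half the weight of each circuit of [q]-weight 2, and [|w f|] for each edge
   of the star. The edge [e] makes the family nonempty. *)
pose P := [pred c : {set E} + E | match c with
  | inl C => circuit s t C && (0 < wt q C) | inr f => ends s t f v end].
pose F (c : {set E} + E) : R := match c with inl C => wt w C / 2 | inr f => `|w f| end.
have Pe : P (inr e) by exact: ev.
case: (arg_minP F Pe) => c Pc minc.
have [eps epsE] : exists eps, eps = F c by exists (F c).
rewrite -epsE in minc.
have eps0 : 0 < eps.
  rewrite epsE /F; case: c Pc {minc epsE} => [C /andP[/qC[->|[_ H] _]]|f /= fv].
  - by rewrite ltxx.
  - lra.
  - rewrite normr_gt0; apply: nz; move: fv; rewrite /ends; apply: contraTneq => ->.
    by rewrite addbb.
pose w' f := w f - eps * q f.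
(* The bounds concern circuits only; decomposition into disjoint circuits extends them to all even
   sets and shows that tight even sets stay tight. *)
have indC : forall C, even_set s t C -> [/\ 0 <= wt w C, wt w C = 0 -> wt q C = 0 & 0 <= wt w' C].
  apply: even_circuit_ind => [|C D cC eD dis [H1 H2 H3]].
    by rewrite /wt !big_set0.
  have [eC _ _] := circuitP _ _ _ cC.
  rewrite !wtU //; have wC := cw _ eC.
  have w'C : 0 <= wt w' C.
    rewrite wtB; case: (qC _ cC) => [->|[q2 wC0]]; first by rewrite mulr0 subr0.
    have : eps <= F (inl C) by apply: minc; rewrite /= cC q2 ltr0n.
    by rewrite /F q2 => ?; lra.
  split; [lra| |lra].
  move=> wCD; have wC0 : wt w C = 0 by lra.
  rewrite H2; last lra.
  by case: (qC _ cC) => [->|[_]]; rewrite ?addr0 // wC0 ltxx.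
exists w'; split.
- by move=> C /indC[].
- have -> : dot w' d = dot w d - eps * dot q d by rewrite dotBl.
  (* This is cut domination for the cut around [v] and its edge [e]. *)
  suff : 0 <= dot q d by nra.
  rewrite /dot (bigD1 e) //= q_e.
  have endsE f : ((s f == v) != (t f == v)) = ends s t f v.
    by rewrite /ends; case: (s f == v); case: (t f == v).
  have := dd [set v] e; rewrite !inE endsE ev => /(_ isT).
  rewrite (bigID (fun f => ends s t f v) (fun f => f != e)) /= [X in _ -> 0 <= _ + (_ + X)]big1; last first.
    by move=> f /andP[_ /negbTE/q_0 ->]; rewrite mul0r.
  under [X in _ -> 0 <= _ + (X + _)]eq_bigr => f /andP[fe fv] do rewrite q_1 // mul1r.
  move=> le; rewrite addr0 mulN1r addrC subr_ge0; apply: le_trans le _.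
  rewrite le_eqVlt; apply/orP; left; apply/eqP/eq_bigl => f.
  by rewrite !inE endsE andbC.
have sub1 : [set C | even_set s t C && (wt w' C != 0)] \subset [set C | even_set s t C && (wt w C != 0)].
  apply/subsetP => C; rewrite !inE => /andP[eC]; rewrite eC /=; apply: contraNneq => wC.
  by have [_ H _] := indC _ eC; rewrite wtB H // wC mulr0 subr0.
have sub2 : [set f | w' f != 0] \subset [set f | w f != 0].
  apply/subsetP => f; rewrite !inE; apply: contraNneq => wf.
  rewrite /w' wf q_0 ?mulr0 ?subr0 //; apply/negbTE/negP => fv.
  have /nz : s f != t f by move: fv; rewrite /ends; apply: contraTneq => ->; rewrite addbb.
  by rewrite wf eqxx.
rewrite /slack_count; case: c Pc epsE {minc} => [C /andP[cC q0]|f /= fv] epsE.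
  rewrite -addSn leq_add ?subset_leq_card //; apply: proper_card; rewrite properE sub1 /=.
  have [eC _ _] := circuitP _ _ _ cC.
  apply/subsetPn; exists C; rewrite !inE eC /=.
    by case: (qC _ cC) q0 => [->|[_ /gt_eqF ->//]]; rewrite ltxx.
  rewrite wtB epsE /F; case: (qC _ cC) q0 => [->|[-> _] _]; first by rewrite ltxx.
  by rewrite divfK ?subrr ?eqxx // pnatr_eq0.
rewrite -addnS leq_add ?subset_leq_card //; apply: proper_card; rewrite properE sub2 /=.
apply/subsetPn; exists f; rewrite !inE.
  by apply: nz; move: fv; rewrite /ends; apply: contraTneq => ->; rewrite addbb.
rewrite negbK /w' epsE; have [->|fe] := eqVneq f e.
  by rewrite q_e ltr0_norm // mulrNN mulr1 subrr.
by rewrite q_1 // gtr0_norm ?pos // mulr1 subrr.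
Qed.

(** The dual form of Seymour's theorem on sums of circuits. Non-loops of weight zero are contracted
    and weight is shifted at pivot vertices, which never increases the pairing, until all weights
    are nonnegative. *)
Theorem conservative_dot_ge0 s t w d : conservative s t w -> (forall e, 0 <= d e) ->
  cut_dominated s t d -> 0 <= dot w d.
Proof.
move=> cw d0; have [n] := ubnP #|[set e | s e != t e]|.
elim: n s t w cw => // n IHn s t w cw leEn.
have [m] := ubnP (slack_count s t w); elim: m w cw => // m IHm w cw lem dd.
have [[f sf wf]|nz] := pselect (exists2 f, s f != t f & w f = 0).
  apply: (IHn (merge s t f \o s) (merge s t f \o t)).
  - exact: conservative_merge.
  - exact: leq_trans (nloop_merge sf) _.
  - exact: cut_dominated_merge.
have [ex|nneg] := pselect (exists e, w e < 0); last first.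
  apply: sumr_ge0 => e _; rewrite mulr_ge0 // leNgt; apply/negP => we.
  by apply: nneg; exists e.
have [|w' [cw' le sl]] := conservative_step cw dd _ ex.
  by move=> e se; apply/eqP => we; apply: nz; exists e.
by apply: le_trans le; apply: IHm => //; exact: leq_trans sl _.
Qed.

End Core.

(** * Even dart sets are cuts *)

Section ClassMatrix.
Variables (T : finType) (e : rel T).
Hypothesis e_sym : connect_sym e.
Local Notation K := 'F_2.

Definition rowfun (f : T -> K) : 'rV[K]_#|T| := \row_j f (enum_val j).
Definition class_mx : 'M[K]_(#|roots e|, #|T|) :=
  \matrix_(i, j) (fingraph.root e (enum_val j) == enum_val i)%:R.

Lemma class_mx_rank : \rank class_mx = #|roots e|.
Proof.
apply/eqP/row_freeP.
exists (\matrix_(j, i) ((enum_val j : T) == enum_val i)%:R).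
apply/matrixP => i k; rewrite !mxE (bigD1 (enum_rank (enum_val k))) //= !mxE enum_rankK eqxx mulr1.
rewrite big1 ?addr0 => [|j jk]; last first.
  rewrite !mxE [X in _ * X](_ : _ = 0) ?mulr0 //; case: eqP => // jk'.
  by rewrite -jk' enum_valK eqxx in jk.
have /eqP -> := enum_valP k; rewrite (inj_eq enum_val_inj) eq_sym.
by case: (i == k).
Qed.

Lemma root_index x : exists k : 'I_#|roots e|, enum_val k = fingraph.root e x.
Proof.
have rx : fingraph.root e x \in roots e by exact: roots_root.
by exists (enum_rank_in rx (fingraph.root e x)); rewrite enum_rankK_in.
Qed.

Lemma rowfun_class f : (forall x y, e x y -> f x = f y) -> (rowfun f <= class_mx)%MS.
Proof.
move=> fe.
have fc x y : connect e x y -> f x = f y.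
  case/connectP => p; elim: p x => [x _ -> //|z p IH x /= /andP[/fe -> ep] ly].
  exact: IH ep ly.
apply/submxP; exists (\row_i f (enum_val i)); apply/rowP => j; rewrite !mxE.
have [k kE] := root_index (enum_val j).
rewrite (bigD1 k) //= !mxE kE eqxx mulr1.
rewrite big1 ?addr0 => [|i ij]; first exact/fc/connect_root.
rewrite !mxE [X in _ * X](_ : _ = 0) ?mulr0 //; case: eqP => // ij'.
by move: ij; rewrite -(inj_eq enum_val_inj) kE ij' eqxx.
Qed.

Lemma class_rowfun (u : 'rV[K]_#|T|) : (u <= class_mx)%MS ->
  forall x y, connect e x y -> u 0 (enum_rank x) = u 0 (enum_rank y).
Proof.
case/submxP => D -> x y xy; rewrite !mxE; apply: eq_bigr => i _; rewrite !mxE !enum_rankK.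
by congr (_ * _); rewrite (fingraph.rootP e_sym xy).
Qed.

End ClassMatrix.

Lemma F2_addr_neq0 (x y : 'F_2) : (x + y != 0) = (x != 0) (+) (y != 0).
Proof. by case: x y => [[|[|//]] ?] [[|[|//]] ?]. Qed.

Lemma F2_addrr (x : 'F_2) : x + x = 0.
Proof. by apply/eqP; rewrite -[_ == _]negbK F2_addr_neq0 addbb. Qed.

Lemma F2_natr_addb (b c : bool) : (b (+) c)%:R = b%:R + c%:R :> 'F_2.
Proof. by case: b c => [] []; apply/val_inj. Qed.

Lemma F2_natr_big (I : finType) (P : pred I) (F : I -> bool) :
  (\big[addb/false]_(i | P i) F i)%:R = \sum_(i | P i) (F i)%:R :> 'F_2.
Proof. by apply: (big_morph (fun b : bool => b%:R : 'F_2) F2_natr_addb). Qed.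

Lemma involution_connect (T : finType) (v : T -> T) : involutive v ->
  forall x y, fconnect v x y = (y \in [:: x; v x]).
Proof.
move=> vK x y; apply/idP/idP => [|]; last first.
  by rewrite !inE => /orP[] /eqP ->; [exact: connect0|exact: fconnect1].
case/iter_findex; move: (findex _ _ _) => n <-.
elim: n => [|n]; rewrite ?mem_head //= !inE => /orP[] /eqP ->; rewrite ?eqxx ?orbT //.
by rewrite vK eqxx.
Qed.

Section Duality.
Variables (T : finType) (r v : T -> T).
Hypothesis r_inj : injective r.
Hypothesis vK : involutive v.
Hypothesis v_free : forall d, v d != d.
Let ph d := r (v d).
Hypothesis euler : (fcard r predT + fcard v predT + fcard ph predT =
   #|T| + 2 * n_comp (relU (frel r) (frel v)) predT)%N.
Local Notation K := 'F_2.

Let v_inj : injective v := can_inj vK.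
Let ph_inj : injective ph := inj_comp r_inj v_inj.
Let rU := relU (frel r) (frel v).
Let rU_sym : connect_sym rU := relU_sym (fconnect_sym r_inj) (fconnect_sym v_inj).

Let Rev : 'M[K]_#|T| := \matrix_(i, j) ((enum_val i : T) == v (enum_val j))%:R.

Lemma mul_rev (u : 'rV[K]_#|T|) x : (u *m Rev) 0 (enum_rank x) = u 0 (enum_rank (v x)).
Proof.
rewrite mxE (bigD1 (enum_rank (v x))) //= mxE !enum_rankK eqxx mulr1 big1 ?addr0 // => i ix.
rewrite !mxE enum_rankK [X in _ * X](_ : _ = 0) ?mulr0 //; case: eqP => // ij.
by rewrite -ij enum_valK eqxx in ix.
Qed.

Lemma fcardE (f : T -> T) : fcard f predT = #|roots (frel f)|.
Proof. by apply: eq_card => x; rewrite !inE andbT. Qed.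

Lemma rowfunE (u : 'rV[K]_#|T|) : u = rowfun (fun x => u 0 (enum_rank x)).
Proof. by apply/rowP => j; rewrite mxE enum_valK. Qed.

(** Rank and nullity: an [f]-invariant function killed by [1 + Rev] is also invariant under [v],
    hence under [r], hence constant on components. *)
Lemma fixed_rank (f : T -> T) : injective f -> (forall h : T -> K, (forall x, h (f x) = h x) ->
     (forall x, h (v x) = h x) -> forall x, h (r x) = h x) ->
  (fcard f predT <= \rank (class_mx (frel f) *m (1%:M + Rev)) + n_comp rU predT)%N.
Proof.
move=> f_inj H; have rk := mxrank_mul_ker (class_mx (frel f)) (1%:M + Rev).
have {}rk := etrans rk (etrans (class_mx_rank _) (esym (fcardE f))).
rewrite -{}rk leq_add2l.
have -> : n_comp rU predT = #|roots rU| by apply: eq_card => x; rewrite !inE andbT.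
rewrite -(class_mx_rank rU); apply: mxrankS.
apply/rV_subP => u; rewrite sub_capmx => /andP[uf /sub_kermxP uk].
rewrite (rowfunE u).
have uv x : u 0 (enum_rank (v x)) = u 0 (enum_rank x).
  have := congr1 (fun z : 'rV_#|T| => z 0 (enum_rank x)) uk.
  rewrite mulmxDr mulmx1 [X in X = _]mxE mul_rev [X in _ = X]mxE.
  by move/(congr1 (fun z => u 0 (enum_rank x) + z)); rewrite addrA F2_addrr add0r addr0.
have uf' x : u 0 (enum_rank (f x)) = u 0 (enum_rank x).
  by apply/esym; apply: (class_rowfun (fconnect_sym f_inj) uf); exact: fconnect1.
have ur := H _ uf' uv.
by apply: (rowfun_class rU_sym) => x y /orP[/eqP <-|/eqP <-]; rewrite ?ur ?uv.
Qed.

(** Both sides have their ones at the pairs inside a common orbit [{x, v x}]. The factorisation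
    relates [1 + Rev] to the incidence of edges with faces. *)
Lemma rev_gram : (class_mx (frel v))^T *m class_mx (frel v) = 1%:M + Rev.
Proof.
apply/matrixP => i j; rewrite !mxE.
have [k0 k0E] := root_index (fconnect_sym v_inj) (enum_val i).
rewrite (bigD1 k0) //= !mxE k0E eqxx mul1r.
rewrite big1 ?addr0 => [|k ki]; last first.
  rewrite !mxE [X in X * _](_ : _ = 0) ?mul0r //; case: eqP => // ki'.
  by move: ki; rewrite -(inj_eq enum_val_inj) k0E ki' eqxx.
rewrite (root_connect (fconnect_sym v_inj)) -F2_natr_addb; congr (_ %:R).
have -> : fconnect v (enum_val j) (enum_val i) = (enum_val i \in [:: enum_val j; v (enum_val j)]).
  exact: involution_connect.
rewrite !inE (inj_eq enum_val_inj).
have [->|//] := eqVneq i j.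
by rewrite eq_sym (negPf (v_free _)).
Qed.

(** The cut space [A] lies in the space [B] of edge sets meeting every face evenly. With c
    components, [A] has dimension at least V - c and [B] at most E - F + c; Euler's formula makes
    the two bounds equal. *)
Lemma face_even_is_cut (C : {set T}) : (forall d, (v d \in C) = (d \in C)) ->
  (forall f, \big[addb/false]_(d in C) (froot ph d == f) = false) ->
  exists2 h : T -> bool, (forall d, h (r d) = h d) &
    forall d, (d \in C) = h d (+) h (v d).
Proof.
move=> Cv Cf.
pose Pr := class_mx (frel r); pose Pv := class_mx (frel v); pose Pf := class_mx (frel ph).
pose A := Pr *m (1%:M + Rev); pose B := (Pv :&: kermx Pf^T)%MS.
have AB : (A <= B)%MS.
  apply/rV_subP => u /submxP[D ->]; rewrite mulmxA; set h := D *m Pr.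
  have hr x : h 0 (enum_rank (r x)) = h 0 (enum_rank x).
    apply/esym; apply: (@class_rowfun _ (frel r)); rewrite ?submxMl //; last exact: fconnect1.
    exact: fconnect_sym.
  have hE x : (h *m (1%:M + Rev)) 0 (enum_rank x) = h 0 (enum_rank x) + h 0 (enum_rank (v x)).
    by rewrite mulmxDr mulmx1 mxE mul_rev.
  rewrite sub_capmx; apply/andP; split.
    rewrite (rowfunE (h *m _)); apply: rowfun_class => [|x y /eqP <-]; first exact: fconnect_sym.
    by rewrite !hE vK addrC.
  apply/sub_kermxP/rowP => i; rewrite [LHS]mxE [RHS]mxE.
  rewrite (reindex _ (onW_bij _ (@enum_rank_bij T))) /=.
  under eq_bigr do rewrite hE [X in _ * X]mxE [X in _ * X]mxE enum_rankK mulrDl.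
  (* Along a face, [h (ph x)] equals [h (v x)] by rotation invariance, so the two sums cancel in
     characteristic 2. *)
  rewrite big_split /= (reindex_inj ph_inj) /=.
  rewrite -[RHS](F2_addrr (\sum_j h 0 (enum_rank (v j)) * (froot ph j == enum_val i)%:R)).
  congr (_ + _); apply: eq_bigr => x _; congr (_ * _); first exact: (hr (v x)).
  rewrite (_ : froot ph (ph x) = froot ph x) //.
  by apply/esym/eqP; rewrite (root_connect (fconnect_sym ph_inj)) fconnect1.
have BA : (B <= A)%MS.
  have /leqifP := mxrank_leqif_sup AB; case: ifP => // _ lt.
  have k1 := fixed_rank r_inj (fun h H _ => H).
  have k2 : (fcard ph predT <= \rank (Pf *m (1%:M + Rev)) + n_comp rU predT)%N.
    by apply: (fixed_rank ph_inj) => h hf hv x; rewrite -{1}(vK x) -[r _]/(ph _) hf hv.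
  rewrite -rev_gram mulmxA -/Pv in k2.
  have {}k2 := leq_trans k2 (leq_add (mxrankM_maxl (Pf *m Pv^T) Pv) (leqnn _)).
  rewrite -mxrank_tr trmx_mul trmxK in k2.
  have k5 := etrans (mxrank_mul_ker Pv Pf^T) (etrans (class_mx_rank _) (esym (fcardE v))).
  rewrite -/B in k5.
  have k6 : (fcard v predT * 2 = #|T|)%N.
    apply: (fcard_order_set v_inj); last by move=> x y.
    apply/subsetP => x _; rewrite inE; apply/eqP.
    by apply: (@order_cycle _ _ [:: x; v x]); rewrite /= ?vK ?eqxx ?inE ?eqxx // eq_sym v_free.
  move: euler; rewrite -/rU; move: k1 k2 k5 k6 lt; rewrite -/Pr -/A; clear.
  move: #|T| (fcard r _) (fcard v _) (fcard ph _) (n_comp rU _) (\rank _) (\rank A) (\rank B); clear; lia.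
pose u : 'rV[K]_#|T| := rowfun (fun d => (d \in C)%:R).
have uB : (u <= B)%MS.
  rewrite sub_capmx; apply/andP; split.
    by apply: rowfun_class => [|x y /eqP <-]; [exact: fconnect_sym|rewrite Cv].
  apply/sub_kermxP/rowP => i; rewrite !mxE (reindex _ (onW_bij _ (@enum_rank_bij T))) /=.
  under eq_bigr do rewrite !mxE enum_rankK.
  have := congr1 (fun b : bool => b%:R : K) (Cf (enum_val i)).
  rewrite F2_natr_big big_mkcond /= => H; rewrite -[RHS]H; apply: eq_bigr => d _.
  by case: (d \in C); rewrite ?mul1r ?mul0r.
have /submxP[D uD] := submx_trans uB BA; rewrite mulmxA in uD.
exists (fun d => (D *m Pr) 0 (enum_rank d) != 0).
  move=> d; congr (_ != 0); apply/esym; apply: (@class_rowfun _ (frel r)).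
  - exact: fconnect_sym.
  - exact: submxMl.
  - exact: fconnect1.
move=> d; rewrite -F2_addr_neq0 -[X in _ + X]mul_rev.
have -> : (D *m Pr) 0 (enum_rank d) + (D *m Pr *m Rev) 0 (enum_rank d) = (d \in C)%:R.
  have := congr1 (fun z : 'rV_#|T| => z 0 (enum_rank d)) uD.
  by rewrite [X in X = _ -> _]mxE enum_rankK => ->; rewrite mulmxDr mulmx1 [RHS]mxE.
by case: (d \in C).
Qed.

End Duality.

(** * Distances, break points and bonds *)

Section Distance.
Variables (R : realType) (G : sgraph) (l : G -> G -> R).
Hypothesis l_sym : forall u v : G, adj u v -> l u v = l v u.
Hypothesis l_pos : forall u v : G, adj u v -> 0 < l u v.
Local Notation dist := (graph_dist l).

Implicit Types (u v z : G) (p q : seq G).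

(** Distances between different components are 0 by the convention for [inf], so the triangle
    inequality is stated under reachability. *)
Definition reach (u v : G) := exists p : seq G, walk u v p.

Lemma walk_length_cons u v p : walk_length l u (v :: p) = l u v + walk_length l v p.
Proof. by rewrite /walk_length /walk_edges /= big_cons. Qed.

Lemma walk_length_nil u : walk_length l u [::] = 0.
Proof. by rewrite /walk_length big_nil. Qed.

Lemma walk_length_cat u p q :
  walk_length l u (p ++ q) = walk_length l u p + walk_length l (last u p) q.
Proof.
elim: p u => [|v p IH] u /=; first by rewrite walk_length_nil add0r.
by rewrite !walk_length_cons IH addrA.
Qed.

Lemma walk_length_ge0 u p : path (@adj G) u p -> 0 <= walk_length l u p.
Proof.
elim: p u => [|v p IH] u /=; first by rewrite walk_length_nil.
by case/andP => uv /IH H; rewrite walk_length_cons addr_ge0 // ltW // l_pos.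
Qed.

Lemma walk_cat u v z p q : walk u v p -> walk v z q -> walk u z (p ++ q).
Proof.
move=> /andP[pp /eqP lp] /andP[pq /eqP lq]; rewrite /walk cat_path last_cat pp lp pq lq //=.
Qed.

Lemma walk_rev u v p : walk u v p ->
  walk v u (rev (belast u p)) /\ walk_length l v (rev (belast u p)) = walk_length l u p.
Proof.
elim: p u => [|z p IH] u.
  by rewrite /walk /= => /eqP ->; rewrite eqxx !walk_length_nil.
rewrite /walk /= => /andP[/andP[uz pz] lz].
have [|/andP[w1 /eqP w2] w3] := IH z; first by rewrite /walk pz.
rewrite rev_cons -cats1 cat_path last_cat w1 w2 /= adj_sym uz eqxx; split => //.
by rewrite walk_length_cat w2 w3 !walk_length_cons walk_length_nil addr0 addrC (l_sym uz).
Qed.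

Lemma dist_le u v p : walk u v p -> dist u v <= walk_length l u p.
Proof.
move=> w; apply: ge_inf; last by exists p.
by exists 0 => _ [q /andP[pq _] ->]; exact: walk_length_ge0.
Qed.

Lemma le_dist u v c : reach u v -> (forall p, walk u v p -> c <= walk_length l u p) -> c <= dist u v.
Proof.
case=> p w H; apply: lb_le_inf; first by exists (walk_length l u p), p.
by move=> _ [q wq ->]; exact: H.
Qed.

Lemma dist_out u v : ~ reach u v -> dist u v = 0.
Proof.
by move=> nr; rewrite /graph_dist inf_out // => -[[x [p w _]] _]; apply: nr; exists p.
Qed.

Lemma dist_ge0 u v : 0 <= dist u v.
Proof.
have [r|/dist_out ->//] := pselect (reach u v).
by apply: le_dist r _ => p /andP[pp _]; exact: walk_length_ge0.
Qed.

Lemma reach_sym u v : reach u v -> reach v u.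
Proof. by case=> p /walk_rev[w _]; eexists; exact: w. Qed.

Lemma reachxx u : reach u u.
Proof. by exists [::]; rewrite /walk /= eqxx. Qed.

Lemma reach_trans u v z : reach u v -> reach v z -> reach u z.
Proof. by case=> p wp [q wq]; exists (p ++ q); exact: walk_cat wp wq. Qed.

Lemma dist_sym u v : dist u v = dist v u.
Proof.
have le a b : reach a b -> dist a b <= dist b a.
  move=> r; apply: le_dist (reach_sym r) _ => p /walk_rev[w <-]; exact: dist_le.
have [r|nr] := pselect (reach u v).
  by apply/eqP; rewrite eq_le !le //; exact: reach_sym.
by rewrite !dist_out // => /reach_sym.
Qed.

Lemma dist0 u : dist u u = 0.
Proof.
apply/eqP; rewrite eq_le dist_ge0 andbT -(walk_length_nil u) dist_le //.
by rewrite /walk /= eqxx.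
Qed.

Lemma dist_triangle u v z : reach u v -> reach v z -> dist u z <= dist u v + dist v z.
Proof.
move=> uv vz; rewrite -lerBlDr; apply: le_dist uv _ => p wp.
rewrite lerBlDr -lerBlDl; apply: le_dist vz _ => q wq.
rewrite lerBlDl; have /andP[_ /eqP lp] := wp.
rewrite -[in leRHS]lp -walk_length_cat; apply: dist_le; exact: walk_cat wp wq.
Qed.

Lemma reach_adj u v : adj u v -> reach u v.
Proof. by move=> uv; exists [:: v]; rewrite /walk /= uv eqxx. Qed.

Lemma dist_adj u v : adj u v -> dist u v <= l u v.
Proof.
move=> uv; apply: le_trans (@dist_le _ _ [:: v] _) _; first by rewrite /walk /= uv eqxx.
by rewrite walk_length_cons walk_length_nil addr0.
Qed.

End Distance.

Lemma iter_injective (T : Type) (f : T -> T) : injective f -> forall k, injective (iter k f).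
Proof. by move=> f_inj; elim=> [|k IH] x y //= /f_inj /IH. Qed.

Section NextBreak.
Variables (T : finType) (psi : T -> T) (B : {set T}).
Hypothesis psi_inj : injective psi.
Hypothesis B_meets : forall d, exists k, iter k.+1 psi d \in B.

Definition next_break d := iter (ex_minn (B_meets d)).+1 psi d.
(** Fixing the darts outside [B] makes this a permutation of all darts, by which sums can be
    reindexed. *)
Definition next_of b := if b \in B then next_break b else b.

Lemma next_breakP d k : iter k.+1 psi d \in B ->
  (forall i, (0 < i <= k)%N -> iter i psi d \notin B) -> next_break d = iter k.+1 psi d.
Proof.
move=> kB H; rewrite /next_break; case: ex_minnP => m mB mmin; rewrite (_ : m = k) //.
apply/eqP; rewrite eqn_leq mmin //= leqNgt; apply/negP => mk.
by have := H m.+1 mk; rewrite mB.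
Qed.

Lemma next_break_in d : next_break d \in B.
Proof. by rewrite /next_break; case: ex_minnP. Qed.

Lemma next_break_connect d : fconnect psi d (next_break d).
Proof. exact: fconnect_iter. Qed.

Lemma next_break_step d : next_break d = if psi d \in B then psi d else next_break (psi d).
Proof.
case: ifPn => dB; first by apply: (@next_breakP d 0) => // -[|i].
rewrite [RHS]/next_break; case: ex_minnP => m mB mmin.
rewrite -iterSr; apply: next_breakP; first by rewrite iterSr.
case=> [//|[_ //|i]] /= im; apply/negP; rewrite -iterS iterSr => iB.
by have := mmin _ iB; rewrite leqNgt -ltnS im.
Qed.

Lemma next_break_inj : {in B &, injective next_break}.
Proof.
have H x y : x \in B -> y \in B -> next_break x = next_break y ->
    (ex_minn (B_meets x) <= ex_minn (B_meets y))%N -> x = y.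
  rewrite /next_break; case: ex_minnP => m mB mmin; case: ex_minnP => n nB nmin xB yB.
  move=> + mn; have -> : (n.+1 = m.+1 + (n - m))%N by lia.
  rewrite iterD => /(iter_injective psi_inj) xE; case nm: (n - m)%N xE => [|k] //= xE.
  by rewrite xE in xB; have := nmin k xB; lia.
move=> x y xB yB xy; case: (leqP (ex_minn (B_meets x)) (ex_minn (B_meets y))) => le.
  exact: H.
by apply/esym; apply: H => //; exact: ltnW.
Qed.

Lemma next_of_inj : injective next_of.
Proof.
move=> x y; rewrite /next_of; case: ifPn => xB; case: ifPn => yB //.
- exact: next_break_inj.
- by move=> H; rewrite -H next_break_in in yB.
- by move=> H; rewrite H next_break_in in xB.
Qed.

Lemma next_of_connect d : fconnect psi d (next_of d).
Proof. by rewrite /next_of; case: ifP => _; [exact: next_break_connect|exact: connect0]. Qed.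

(** The darts of a block run from [b] to just before the next break, so the sum telescopes. For [b]
    outside [B] no dart qualifies and both ends coincide. *)
Lemma block_parity (h : T -> bool) b :
  \big[addb/false]_d ((h d (+) h (psi d)) && (next_break d == next_of b)) =
  h b (+) h (next_of b).
Proof.
under eq_bigr do rewrite andb_addl.
rewrite big_split /=.
have -> : \big[addb/false]_d (h (psi d) && (next_break d == next_of b)) =
          \big[addb/false]_d (h d && ((if d \in B then d else next_break d) == next_of b)).
  rewrite [RHS](reindex_inj psi_inj); apply: eq_bigr => d _; congr (_ && (_ == _)).
  exact: next_break_step.
rewrite -big_split /=.
rewrite (eq_bigr (fun d => (h d && ((d \in B) && (d == b))) (+) (h d && ((d \in B) && (d == next_of b))))).
  rewrite big_split /=.
  have E c : \big[addb/false]_d (h d && ((d \in B) && (d == c))) = h c && (c \in B).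
    rewrite (bigD1 c) //= eqxx andbT big1 ?addbF // => d /negPf ->.
    by rewrite !andbF.
  rewrite !E /next_of; case bB: (b \in B); first by rewrite next_break_in !andbT.
  by rewrite bB !andbF !addbb.
move=> d _; case dB: (d \in B) => /=; last by rewrite addbb !andbF.
congr (_ (+) _); congr (_ && _).
rewrite /next_of; case: ifPn => bB.
  by apply/eqP/eqP => [/next_break_inj -> //|->].
have [db|db] := eqVneq d b; first by rewrite -db dB in bB.
by apply/negbTE; apply: contraNneq bB => <-; exact: next_break_in.
Qed.

End NextBreak.

Lemma perm_telescope (T : finType) (p : T -> T) (h g : T -> bool) : injective p ->
  (forall x, g (p x) = g x) ->
  \big[addb/false]_x ((h x (+) h (p x)) && g x) = false.
Proof.
move=> p_inj gp; under eq_bigr do rewrite andb_addl.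
rewrite big_split /= (reindex_inj p_inj) /=.
by under eq_bigr do rewrite gp; rewrite addbb.
Qed.

(** * Cuts, bonds and the planar dual *)

Section Cuts.
Variable G : sgraph.
Implicit Types (S : {set G}) (d : dart G) (u v : G).

Definition sep S u v := (u \in S) (+) (v \in S).
Definition cut S : {set dart G} := [set d | sep S (dart_src d) (dart_tgt d)].
Definition bond S := (cut S != set0) &&
  [forall S' : {set G}, (cut S' \subset cut S) && (cut S' != set0) ==> (cut S' == cut S)].

Lemma dart_revK : involutive (@dart_rev G).
Proof. by move=> d; apply/val_inj; rewrite /= /dart_src /dart_tgt /= -surjective_pairing. Qed.

Lemma dart_rev_free d : dart_rev d != d.
Proof.
apply/eqP => e; have ts : dart_tgt d = dart_src d by rewrite -[in RHS]e.
by have := valP d; rewrite /= -/(dart_src d) -/(dart_tgt d) ts adj_irrefl.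
Qed.

Lemma sep_sdiff S S' u v : sep (sdiff S S') u v = sep S u v (+) sep S' u v.
Proof. by rewrite /sep !inE; do 4 case: (_ \in _). Qed.

Lemma cut_sdiff S S' : cut (sdiff S S') = sdiff (cut S) (cut S').
Proof. by apply/setP => d; rewrite !inE sep_sdiff. Qed.

Lemma sep_trans S u v z : sep S u z = sep S u v (+) sep S v z.
Proof. by rewrite /sep -addbA; congr addb; rewrite addbA addbb addFb. Qed.

Lemma sep_xx S u : sep S u u = false.
Proof. exact: addbb. Qed.

Lemma sepC S u v : sep S u v = sep S v u.
Proof. exact: addbC. Qed.

Lemma cut_mem S d : (d \in cut S) = sep S (dart_src d) (dart_tgt d).
Proof. by rewrite inE. Qed.

Lemma cut_rev S d : (dart_rev d \in cut S) = (d \in cut S).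
Proof. by rewrite !cut_mem sepC. Qed.

Lemma walk_cut S u v p : walk u v p -> sep S u v ->
  exists2 d, d \in cut S & val d \in walk_edges u p.
Proof.
elim: p u => [|z p IH] u; rewrite /walk /=; first by move=> /eqP ->; rewrite sep_xx.
case/andP => /andP[uz pz] lz; rewrite (sep_trans _ _ z).
case uzS: (sep S u z) => /=; [move=> _|move=> zv].
  by exists (exist _ (u, z) uz : dart G); rewrite ?cut_mem //= mem_head.
have [|d dS dp] := IH z _ zv; first by rewrite /walk pz.
by exists d => //; rewrite in_cons dp orbT.
Qed.

Lemma cut0_sep S u v : cut S = set0 -> reach u v -> sep S u v = false.
Proof.
move=> S0 [p w]; apply/negbTE/negP => /(walk_cut w)[d].
by rewrite S0 inE.
Qed.

Lemma bondP S S' : bond S -> cut S' \subset cut S -> cut S' != set0 -> cut S' = cut S.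
Proof. by case/andP => _ /forallP/(_ S') + sS S0; rewrite sS S0 => /eqP. Qed.

Lemma bond_sub S : cut S != set0 -> exists2 S1, bond S1 & cut S1 \subset cut S.
Proof.
move=> S0; pose P := [pred S' | (cut S' \subset cut S) && (cut S' != set0)].
have PS : P S by rewrite /= subxx.
case: (arg_minnP (fun S' => #|cut S'|) PS) => S1 /andP[sS1 S10] mS1.
exists S1 => //; apply/andP; split => //; apply/forallP => S2; apply/implyP => /andP[s20 S20].
by rewrite eqEcard s20 mS1 //= S20 (subset_trans s20).
Qed.

(** Every cut is a disjoint union of bonds, peeled off one at a time. *)
Lemma bond_ind (P : {set G} -> Prop) :
  (forall S, cut S = set0 -> P S) ->
  (forall S S1, bond S1 -> cut S1 \subset cut S -> P (sdiff S S1) -> P S) ->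
  forall S, P S.
Proof.
move=> P0 PI S; have [n] := ubnP #|cut S|; elim: n S => // n IH S leS.
have [/P0 //|S0] := eqVneq (cut S) set0.
have [S1 bS1 sS1] := bond_sub S0; apply: (PI _ _ bS1 sS1).
apply: IH; rewrite cut_sdiff sdiff_sub // cardsD (setIidPr sS1).
have : (0 < #|cut S1|)%N by rewrite card_gt0; case/andP: bS1.
have := subset_leq_card sS1; lia.
Qed.

(** The cut around [u] separates the pair; separation is additive mod 2, so one of the bonds
    composing this cut separates it too. *)
Lemma bond_sep u v : reach u v -> u != v -> exists2 S, bond S & sep S u v.
Proof.
move=> r uv; have : sep [set u] u v by rewrite /sep !inE eqxx eq_sym (negPf uv).
move: [set u]; apply: bond_ind => [S /cut0_sep/(_ r) -> //|S S1 bS1 _ IH].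
case S1uv: (sep S1 u v) => Suv; first by exists S1.
by apply: IH; rewrite sep_sdiff Suv S1uv.
Qed.

Lemma cut_orbit_even (psi : dart G -> dart G) S f : injective psi ->
  (forall d, dart_src (psi d) = dart_tgt d) ->
  \big[addb/false]_(d in cut S) (froot psi d == f) = false.
Proof.
move=> psi_inj psi_src.
apply: etrans (@perm_telescope _ psi (fun d => dart_src d \in S) (fun d => froot psi d == f) psi_inj _).
  rewrite big_mkcond; apply: eq_bigr => d _; rewrite cut_mem /sep psi_src.
  by case: ifP.
move=> d; congr (_ == _); apply/eqP.
by rewrite (root_connect (fconnect_sym psi_inj)) (fconnect_sym psi_inj) fconnect1.
Qed.

Section Planar.
Variable M : planar_embedding G.
Local Notation phi := (next_on_face (rot M)).

Lemma phi_inj : injective phi.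
Proof. by move=> x y /(@rot_inj _ M)/(can_inj dart_revK). Qed.

Lemma rot_src d : dart_src (rot M d) = dart_src d.
Proof. by apply/esym/eqP; rewrite -(rot_orbit M) fconnect1. Qed.

Lemma phi_src d : dart_src (phi d) = dart_tgt d.
Proof. by rewrite rot_src. Qed.

Lemma even_dart_cut (C : {set dart G}) : (forall d, (dart_rev d \in C) = (d \in C)) ->
  (forall f, \big[addb/false]_(d in C) (froot phi d == f) = false) ->
  exists S, C = cut S.
Proof.
move=> Cv Cf; have [h hr hC] := face_even_is_cut (@rot_inj _ M) dart_revK dart_rev_free
  (rot_planar M) Cv Cf.
have hc x y : dart_src x = dart_src y -> h x = h y.
  move/eqP; rewrite -(rot_orbit M) => /iter_findex <-.
  by elim: (findex _ _ _) => //= n ->; rewrite hr.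
exists [set u | [exists d, (dart_src d == u) && h d]].
have hS d : (dart_src d \in [set u | [exists d, (dart_src d == u) && h d]]) = h d.
  rewrite inE; apply/existsP/idP => [[d' /andP[/eqP /hc <- //]]|hd].
  by exists d; rewrite eqxx.
by apply/setP => d; rewrite hC cut_mem /sep hS -[dart_tgt d]/(dart_src (dart_rev d)) hS.
Qed.

(** The dual graph with subdivided edges: a dart joins its face to the midpoint of its edge.
    Evenness at a midpoint keeps a dart and its reverse together. *)
Definition dual_src d : dart G + dart G := inl (froot phi d).
Definition dual_tgt d : dart G + dart G := inr (froot (@dart_rev G) d).

Lemma rev_root_eq d d' :
  (froot (@dart_rev G) d' == froot (@dart_rev G) d) = (d' == d) || (d' == dart_rev d).
Proof.
have rI := can_inj dart_revK.
rewrite (root_connect (fconnect_sym rI)) (fconnect_sym rI) (involution_connect dart_revK).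
by rewrite !inE.
Qed.

Lemma rev_parity (C : {set dart G}) d :
  \big[addb/false]_(x in C) (froot (@dart_rev G) x == froot (@dart_rev G) d) =
  (d \in C) (+) (dart_rev d \in C).
Proof.
under eq_bigr do rewrite rev_root_eq.
rewrite big_mkcond (bigD1 d) //= (bigD1 (dart_rev d)) /=; last by rewrite dart_rev_free.
rewrite !eqxx orbT big1 ?addbF => [|x /andP[/negPf -> /negPf ->]]; last by rewrite if_same.
by do 2 case: (_ \in _).
Qed.

Lemma dual_even_cut (C : {set dart G}) : even_set dual_src dual_tgt C -> exists S, C = cut S.
Proof.
move=> eC; apply: even_dart_cut => [d|f].
  have := even_test (fun x => if x is inr e then e == froot (@dart_rev G) d else false) eC.
  rewrite /= rev_parity; by case: (_ \in _); case: (_ \in _).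
have := even_test (fun x => if x is inl e then e == f else false) eC.
by under eq_bigr do rewrite /= addbF.
Qed.

Lemma cut_dual_even S : even_set dual_src dual_tgt (cut S).
Proof.
apply/evenP => -[f|e]; rewrite /bdry /ends /=.
  under eq_bigr do rewrite addbF.
  exact: cut_orbit_even phi_inj phi_src.
apply: etrans (@perm_telescope _ (@dart_rev G) (fun d => dart_src d \in S)
   (fun d => froot (@dart_rev G) d == e) (can_inj dart_revK) _).
  rewrite big_mkcond; apply: eq_bigr => d _; rewrite cut_mem /sep.
  by rewrite -[dart_src (dart_rev d)]/(dart_tgt d); case: ifP.
by move=> d; congr (_ == _); apply/eqP; rewrite rev_root_eq eqxx orbT.
Qed.

Lemma bond_circuit S : bond S -> circuit dual_src dual_tgt (cut S).
Proof.
move=> bS; apply/circuitP; split; [exact: cut_dual_even|by case/andP: bS|].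
move=> C' sC' /dual_even_cut[S' C'E]; rewrite C'E in sC' *.
have [|S'0] := eqVneq (cut S') set0; [by left|right; exact: bondP].
Qed.

(** A bond is a circuit of the dual, hence has degree at most 2 at the dual vertex given by a
    face. *)
Lemma bond_face S d1 d2 d3 : bond S -> d1 \in cut S -> d2 \in cut S -> d3 \in cut S ->
  froot phi d1 = froot phi d2 -> froot phi d1 = froot phi d3 -> d1 != d2 ->
  d3 = d1 \/ d3 = d2.
Proof.
move=> bS c1 c2 c3 e2 e3 d12.
have E d : ends dual_src dual_tgt d (inl (froot phi d1)) = (froot phi d == froot phi d1).
  by rewrite /ends /= addbF.
have [|f' [_ _ _ H]] := circuit_deg2 (v := inl (froot phi d1)) (bond_circuit bS) c1.
  by rewrite E.
have [|/esym/eqP|->] := H _ c2; first by rewrite E -e2.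
  by rewrite (negPf d12).
by apply: H c3 _; rewrite E -e3.
Qed.

End Planar.
End Cuts.

(** * A packing of bonds that is exact on the chords *)

Section Packing.
Variables (R : realType) (G : sgraph) (M : planar_embedding G) (l : G -> G -> R).
Hypothesis l_sym : forall u v : G, adj u v -> l u v = l v u.
Hypothesis l_pos : forall u v : G, adj u v -> 0 < l u v.
Local Notation dist := (graph_dist l).
Local Notation phi := (next_on_face (rot M)).
Local Notation T := (dart G).
Variable psi : T -> T.
Implicit Types (d b : T) (e : T + T) (S : {set G}).
Hypothesis psi_inj : injective psi.
Hypothesis psi_src : forall d, dart_src (psi d) = dart_tgt d.
Hypothesis psi_face : forall d, fconnect phi d (psi d).

Lemma reach_dart d : reach (dart_src d) (dart_tgt d).
Proof. exact: reach_adj (valP d). Qed.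

Lemma reach_psi d d' : fconnect psi d d' -> reach (dart_src d) (dart_src d').
Proof.
move=> /iter_findex <-; elim: (findex _ _ _) => [|n IH] /=; first exact: reachxx.
by apply: reach_trans IH _; rewrite psi_src; exact: reach_dart.
Qed.

Lemma psi_face_connect d d' : fconnect psi d d' -> fconnect phi d d'.
Proof.
move=> /iter_findex <-; elim: (findex _ _ _) => [|n IH] /=; first exact: connect0.
exact: connect_trans IH (psi_face _).
Qed.

Lemma psi_face_root d d' : fconnect psi d d' -> froot phi d = froot phi d'.
Proof.
by move=> /psi_face_connect dd'; apply/eqP; rewrite (root_connect (fconnect_sym (@phi_inj _ M))).
Qed.

Variable B : {set T}.
Hypothesis B_meets : forall d, exists k, iter k.+1 psi d \in B.
Local Notation N := (next_break B_meets).
Local Notation nb := (next_of B_meets).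

(* The planar graph obtained from G by adding, inside each face, the chord
   from every break corner b to the next one. [chord_src], [chord_tgt] are the
   ends of its edges; [block_src], [block_tgt] are those of the dual edges, with
   every edge of G doubled and the digon between the two copies kept as a dual
   vertex. *)
Definition chord_src (e : T + T) : G :=
  match e with inl d => dart_src d | inr b => dart_src b end.
Definition chord_tgt (e : T + T) : G :=
  match e with inl d => dart_tgt d | inr b => dart_src (nb b) end.
Definition block_src (e : T + T) : T + (T + T) :=
  match e with inl d => inl (N d) | inr b => inl (nb b) end.
Definition block_tgt (e : T + T) : T + (T + T) :=
  match e with
  | inl d => inr (inl (froot (@dart_rev G) d))
  | inr b => inr (inr (froot psi b))
  end.
Definition chord_dist e := dist (chord_src e) (chord_tgt e).

Lemma reach_chord e : reach (chord_src e) (chord_tgt e).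
Proof.
case: e => [d|b] /=; first exact: reach_dart.
by apply: reach_psi; exact: next_of_connect.
Qed.

(** Summing parities over all blocks of a face cancels the chords, so the darts in [C] form a cut. A
    single block has only the chord [b], whose membership is the parity of the darts there, and this
    telescopes along the block. *)
Lemma block_even_cut C : even_set block_src block_tgt C ->
  exists S, forall e, (e \in C) = sep S (chord_src e) (chord_tgt e).
Proof.
move=> eC; pose C0 := [set d | inl d \in C].
have test (Y : T + (T + T) -> bool) :
    \big[addb/false]_(d in C0) (Y (inl (N d)) (+) Y (inr (inl (froot (@dart_rev G) d)))) =
    \big[addb/false]_(b | inr b \in C) (Y (inl (nb b)) (+) Y (inr (inr (froot psi b)))).
  have := even_test Y eC; rewrite big_mkcond big_sumType /= -!big_mkcond /=.
  rewrite (eq_bigl (fun d => d \in C0)) => [|d]; last by rewrite inE.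
  by move/negbT; rewrite negb_add => /eqP.
have [S C0E] : exists S, C0 = cut S.
  apply: (@even_dart_cut _ M) => [d|f].
    have := test (fun x => if x is inr (inl e) then e == froot (@dart_rev G) d else false).
    rewrite /= rev_parity big1 //; by do 2 case: (_ \in _).
  have := test (fun x => match x with inl e => froot phi e == f
     | inr (inr e) => froot phi e == f | _ => false end).
  rewrite /= [RHS]big1 => [|b _]; last first.
    rewrite -(psi_face_root (next_of_connect B_meets b)).
    by rewrite -(psi_face_root (connect_root _ b)) addbb.
  move=> H; rewrite -[RHS]H; apply: eq_bigr => d _; rewrite addbF.
  by rewrite (psi_face_root (next_break_connect B_meets d)).
exists S; case=> [d|b] /=.
  by have /setP/(_ d) := C0E; rewrite !inE.
have H : \big[addb/false]_(d in C0) (N d == nb b) = (inr b \in C).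
  have E := test (fun x => if x is inl e then e == nb b else false).
  transitivity (\big[addb/false]_(d in C0) ((N d == nb b) (+) false)).
    by apply: eq_bigr => d _; rewrite addbF.
  apply: etrans E _; rewrite big_mkcond (bigD1 b) //= eqxx big1 => [|b' b'b].
    by case: (_ \in _).
  by rewrite (inj_eq (next_of_inj psi_inj (B_meets := B_meets))) (negPf b'b) if_same.
rewrite -H /sep -(block_parity psi_inj B_meets (fun d => dart_src d \in S)).
rewrite big_mkcond; apply: eq_bigr => d _.
have -> : (d \in C0) = (dart_src d \in S) (+) (dart_src (psi d) \in S).
  by rewrite C0E cut_mem psi_src.
by case: ifP; rewrite ?addbF.
Qed.

(** Cuts of the dual are cycles of the graph with chords. Splitting by the three kinds of dual
    vertices, the terms cancel in pairs after reindexing by [psi], [dart_rev] and the chord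
    permutation. *)
Lemma block_cut_even (X : {set T + (T + T)}) :
  even_set chord_src chord_tgt [set e | (block_src e \in X) != (block_tgt e \in X)].
Proof.
pose X1 d := inl d \in X; pose X2 d := inr (inl d) \in X; pose X3 d := inr (inr d) \in X.
apply/evenP => x; rewrite /bdry big_mkcond.
pose at_ d := dart_src d == x.
rewrite (eq_bigr (fun e => match e with
   | inl d => (X1 (N d) (+) X2 (froot (@dart_rev G) d)) && (at_ d (+) at_ (psi d))
   | inr b => (X1 (nb b) (+) X3 (froot psi b)) && (at_ b (+) at_ (nb b)) end)); last first.
  case=> [d|b] _; rewrite inE /= /ends /at_ /= ?psi_src -/(X1 _) -/(X2 _) -/(X3 _).
    by case: (X1 _); case: (X2 _).
  by case: (X1 _); case: (X3 _).
rewrite big_sumType /=.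
have split_ (a b : T -> bool) (p : T -> T) :
   \big[addb/false]_d ((a d (+) b d) && (at_ d (+) at_ (p d))) =
   (\big[addb/false]_d (a d && at_ d) (+) \big[addb/false]_d (a d && at_ (p d))) (+)
   (\big[addb/false]_d (b d && at_ d) (+) \big[addb/false]_d (b d && at_ (p d))).
  rewrite -!big_split; apply: eq_bigr => d _ /=.
  by case: (a d); case: (b d); case: (at_ d); case: (at_ (p d)).
rewrite !split_.
have E2 : \big[addb/false]_d (X2 (froot (@dart_rev G) d) && at_ (psi d)) =
          \big[addb/false]_d (X2 (froot (@dart_rev G) d) && at_ d).
  rewrite [RHS](reindex_inj (can_inj (@dart_revK G))); apply: eq_bigr => d _.
  rewrite /at_ psi_src -[dart_src (dart_rev d)]/(dart_tgt d); congr (X2 _ && _).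
  by apply/eqP; rewrite rev_root_eq dart_revK eqxx orbT.
have E3 : \big[addb/false]_d (X3 (froot psi d) && at_ (nb d)) =
          \big[addb/false]_d (X3 (froot psi d) && at_ d).
  rewrite [RHS](reindex_inj (next_of_inj psi_inj (B_meets := B_meets))); apply: eq_bigr => d _.
  congr (X3 _ && _); apply/eqP; rewrite (root_connect (fconnect_sym psi_inj)).
  exact: next_of_connect.
have E1 : \big[addb/false]_d (X1 (nb d) && at_ (nb d)) = \big[addb/false]_d (X1 d && at_ d).
  by rewrite [RHS](reindex_inj (next_of_inj psi_inj (B_meets := B_meets))).
have E4 : \big[addb/false]_d (X1 (N d) && at_ (psi d)) =
          \big[addb/false]_d (X1 (if d \in B then d else N d) && at_ d).
  rewrite [RHS](reindex_inj psi_inj); apply: eq_bigr => d _.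
  by rewrite -next_break_step.
rewrite E1 E2 E3 E4 !addbb !addbF -!big_split big1 //= => d _.
rewrite /next_of; case: ifP => dB; first by rewrite addbb.
by rewrite !addbb.
Qed.

(** By evenness the rest of the cut joins the ends of [e], and the triangle inequality applies. *)
Lemma block_cut_dominated : cut_dominated block_src block_tgt chord_dist.
Proof.
move=> X e eX; set D := [set e | (block_src e \in X) != (block_tgt e \in X)].
have eD : e \in D by rewrite inE.
have J : is_join chord_src chord_tgt (chord_src e) (chord_tgt e) (D :\ e).
  rewrite -sdiff_sub ?sub1set //; apply: (is_join_sdiff (y := chord_src e)).
    by rewrite -even_join; exact: block_cut_even.
  exact: is_join1.
have [|||_ le] := @join_dist _ _ _ _ _ dist (@reach G) (D :\ e) _ _ (dist_sym l_sym l_pos) (reach_sym l_sym) _ _ _ reach_chord J.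
- by move=> u; split; [exact: reachxx|exact: dist0].
- exact: dist_ge0.
- by move=> u v z uv vz; split; [exact: reach_trans uv vz|exact: dist_triangle].
apply: le_trans le _; rewrite le_eqVlt; apply/orP; left; apply/eqP.
by apply: eq_bigl => f; rewrite !inE andbC.
Qed.

Definition chord_sep S e : R := (sep S (chord_src e) (chord_tgt e))%:R.

(** Peel a bond [S1] off [S]. On edges of the graph the separations add up because the cuts are
    nested; on chords separation is only subadditive, which suits the nonpositive weights. *)
Lemma bond_weights_suffice (w : T + T -> R) :
  (forall d, 0 <= w (inl d)) -> (forall b, w (inr b) <= 0) ->
  (forall S, bond S -> 0 <= dot w (chord_sep S)) ->
  forall S, 0 <= dot w (chord_sep S).
Proof.
move=> w1 w2 wb; apply: bond_ind => [S S0|S S1 bS1 sS1 IH].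
  rewrite /dot big1 // => e _; rewrite /chord_sep cut0_sep ?mulr0 //; exact: reach_chord.
apply: le_trans (addr_ge0 (wb _ bS1) IH) _; rewrite /dot -big_split /=.
apply: ler_sum => -[d|b] _ /=; rewrite /chord_sep sep_sdiff /=.
  have := subsetP sS1 d; rewrite !cut_mem.
  case: (sep S1 _ _); last by rewrite addbF /= mulr0 add0r.
  by move=> /(_ isT) ->; rewrite /= mulr0 addr0.
have := w2 b; case: (sep S1 _ _); case: (sep S _ _) => /=;
  rewrite ?mulr1n ?mulr0n; lra.
Qed.

Theorem bond_packing : exists y : {set G} -> R,
  [/\ forall S, 0 <= y S, forall S, ~~ bond S -> y S = 0,
      forall d, \sum_S y S * (d \in cut S)%:R <= dist (dart_src d) (dart_tgt d) &
      forall b k, b \in B -> iter k.+1 psi b \in B ->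
        (forall i, (0 < i <= k)%N -> iter i psi b \notin B) ->
        dist (dart_src b) (dart_src (iter k.+1 psi b)) <=
          \sum_S y S * (sep S (dart_src b) (dart_src (iter k.+1 psi b)))%:R].
Proof.
(* The Farkas generators are the bonds and signed unit vectors acting as slacks: positive on edges,
   giving upper bounds, and negative on chords, giving lower bounds. *)
pose sgn (c : T + T) : R := if c is inl _ then 1 else -1.
pose a (i : {set G} + (T + T)) (e : T + T) : R :=
  match i with inl A => if bond A then chord_sep A e else 0 | inr c => (c == e)%:R * sgn c end.
have [w Hw|y y0 yd] := @farkas R _ _ a chord_dist.
  have dot_unit c : dot w (a (inr c)) = w c * sgn c.
    rewrite /dot (bigD1 c) //= eqxx mul1r big1 ?addr0 // => e ec.
    by rewrite eq_sym (negPf ec) mul0r mulr0.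
  have wS : forall S, 0 <= dot w (chord_sep S).
    apply: bond_weights_suffice => [d|b|S bS].
    - by have := Hw (inr (inl d)); rewrite dot_unit /= mulr1.
    - by have := Hw (inr (inr b)); rewrite dot_unit /= mulrN1 oppr_ge0.
    - by have := Hw (inl S); rewrite /a bS.
  apply: (@conservative_dot_ge0 _ _ _ block_src block_tgt).
  - move=> C /block_even_cut[S CS].
    have := wS S; rewrite /wt /dot [X in _ -> 0 <= X]big_mkcond /=.
    rewrite (eq_bigr (fun e => if e \in C then w e else 0)) // => e _.
    by rewrite /chord_sep -CS; case: ifP; rewrite ?mulr1 ?mulr0.
  - by move=> e; exact: dist_ge0.
  - exact: block_cut_dominated.
pose y' S := if bond S then y (inl S) else 0.
have yE e : chord_dist e = \sum_S y' S * chord_sep S e + y (inr e) * sgn e.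
  rewrite yd big_sumType /=; congr (_ + _).
    by apply: eq_bigr => S _; rewrite /y'; case: ifP; rewrite ?mulr0 ?mul0r.
  rewrite (bigD1 e) //= eqxx mul1r big1 ?addr0 // => c ce.
  by rewrite (negPf ce) mul0r mulr0.
exists y'; split.
- by move=> S; rewrite /y'; case: ifP.
- by move=> S /negPf; rewrite /y' => ->.
- move=> d; have := yE (inl d); rewrite /chord_dist /= mulr1 => ->.
  rewrite -[leLHS]addr0 lerD // le_eqVlt; apply/orP; left; apply/eqP.
  by apply: eq_bigr => S _; rewrite cut_mem.
move=> b k bB kB nB; have := yE (inr b); rewrite /chord_dist /chord_sep /= /next_of bB.
rewrite (next_breakP B_meets kB nB) mulrN1 => ->.
by rewrite gerBl.
Qed.

End Packing.

(** * Break points on a line *)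

Section Line.
Variables (R : realFieldType) (D : nat -> nat -> R) (L : nat -> R) (m : nat).
Hypothesis m_gt0 : (0 < m)%N.
Hypothesis D_triangle : forall i j k, D i k <= D i j + D j k.
Hypothesis L_gt0 : forall i, 0 < L i.
Hypothesis D_wrap : forall i, D i (i + m)%N = 0.
Implicit Types (i j k u v a : nat).

Definition len i j := \sum_(i <= t < j) L t.
Hypothesis D_le_len : forall i j, (i <= j)%N -> D i j <= len i j.
Hypothesis D0 : forall i, D i i = 0.

(** The indices unroll a closed walk of period [m]; [geo] marks the arcs of the walk that are
    shortest paths. *)
Definition geo i j := (i <= j)%N && (D i j == len i j).

Lemma len_cat j i k : (i <= j)%N -> (j <= k)%N -> len i k = len i j + len j k.
Proof. by move=> ij jk; rewrite /len (big_cat_nat ij jk). Qed.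

Lemma len_ge0 i j : 0 <= len i j.
Proof. by apply: sumr_ge0 => t _; exact: ltW. Qed.

Lemma len_gt0 i j : (i < j)%N -> 0 < len i j.
Proof.
move=> ij; rewrite (len_cat (leqnSn i) ij) /len big_nat1.
by apply: ltr_pwDl => //; exact: len_ge0.
Qed.

Lemma geo_refl i : geo i i.
Proof. by rewrite /geo leqnn D0 /len big_geq ?eqxx. Qed.

Lemma geo_sub i j i' j' : geo i j -> (i <= i')%N -> (i' <= j')%N -> (j' <= j)%N -> geo i' j'.
Proof.
move=> /andP[ij /eqP Dij] ii' ij' jj'; rewrite /geo ij' eq_le D_le_len //=.
have := D_triangle i i' j; have := D_triangle i' j' j.
have := D_le_len ii'; have := D_le_len jj'.
have := len_cat (leq_trans ii' ij') jj'; have := len_cat ii' ij'.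
by rewrite Dij; lra.
Qed.

Lemma geoE i j : geo i j -> D i j = len i j.
Proof. by case/andP => _ /eqP. Qed.

Lemma geo_le i j : geo i j -> (i <= j)%N.
Proof. by case/andP. Qed.

(** Subarcs of geodesic arcs are geodesic, but a full turn has distance 0 and positive length. *)
Lemma geo_window i j : geo i j -> (j <= i + m)%N.
Proof.
move=> g; rewrite leqNgt; apply/negP => lt.
have /geoE := geo_sub g (leqnn i) (leq_addr m i) (ltnW lt).
have := @len_gt0 i (i + m); rewrite D_wrap -addn1 leq_add2l => /(_ m_gt0) + e.
by rewrite -e ltxx.
Qed.

Section Pin.
Variable rho : nat -> nat -> R.
Hypothesis rho_triangle : forall i j k, rho i k <= rho i j + rho j k.
Hypothesis rho_sym : forall i j, rho i j = rho j i.
Hypothesis rho_le : forall i j, rho i j <= D i j.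

(** Since [rho] is at most [D], equality over a whole geodesic leaves no slack on its subarcs. *)
Lemma exact_sub u v i j : geo u v -> D u v <= rho u v ->
  (u <= i)%N -> (i <= j)%N -> (j <= v)%N -> len i j <= rho i j.
Proof.
move=> g; rewrite (geoE g) => ex ui ij jv.
have := rho_triangle u i v; have := rho_triangle i j v.
have := le_trans (rho_le u i) (D_le_len ui); have := le_trans (rho_le j v) (D_le_len jv).
have := len_cat (leq_trans ui ij) jv; have := len_cat ui ij.
lra.
Qed.

Variables (us vs a i j : nat) (rhoL rhoR : nat -> nat -> R).
Hypothesis rhoL_triangle : forall i j k, rhoL i k <= rhoL i j + rhoL j k.
Hypothesis rhoL_sym : forall i j, rhoL i j = rhoL j i.
Hypothesis rhoL_le : forall i j, rhoL i j <= D i j.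
Hypothesis rhoR_triangle : forall i j k, rhoR i k <= rhoR i j + rhoR j k.
Hypothesis rhoR_sym : forall i j, rhoR i j = rhoR j i.
Hypothesis rhoR_le : forall i j, rhoR i j <= D i j.
Hypothesis rho_ge0 : forall i j, 0 <= rho i j.
Hypothesis gs : geo us vs.
Hypothesis usa : (us <= a)%N.
Hypothesis avs : (a <= vs)%N.
Hypothesis exs : D us vs <= rho us vs.
Hypothesis g : geo i j.
Hypothesis ia : (i <= a)%N.
Hypothesis aj : (a <= j)%N.
Hypothesis best : Num.min (len i a) (len a j) <= Num.min (len us a) (len a vs).
Hypothesis exL : len i a <= rhoL i a.
Hypothesis exR : len a j <= rhoR a j.

(** Let p <= q be the lengths of the two parts of the arc at [a]. The packing exact on the longer
    part gives q - p. The balanced arc reaches at least p on both sides and gives p + q or at least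
    3p - q. In the latter case the sum is at least the maximum of q - p and 2p, hence at least (p +
    q)/2, the worst case being q = 3p. *)
Lemma pin_bound : D i j / 2 <= rho i j + rhoR i j \/ D i j / 2 <= rho i j + rhoL i j.
Proof.
have r0 := rho_ge0 i j; rewrite (geoE g) (len_cat ia aj).
have [pq|qp] := leP (len i a) (len a j).
  left; move: best; rewrite (min_idPl pq) le_min => /andP[pp pq'].
  have ui : (us <= i)%N.
    rewrite leqNgt; apply/negP => iu; have := len_cat (ltnW iu) usa.
    by have := len_gt0 iu; lra.
  have hR : len a j - len i a <= rhoR i j.
    have := exR; have := rhoR_triangle a i j; rewrite (rhoR_sym a i).
    by have := le_trans (rhoR_le i a) (D_le_len ia); lra.
  have [jv|vj] := leqP j vs.
    have := exact_sub gs exs ui (geo_le g) jv; rewrite (len_cat ia aj).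
    by have := len_ge0 i a; have := len_ge0 a j; lra.
  have := exact_sub gs exs ui (leq_trans ia avs) (leqnn _); rewrite (len_cat ia avs).
  have := rho_triangle i j vs; rewrite (rho_sym j vs).
  have := le_trans (rho_le vs j) (D_le_len (ltnW vj)).
  by have := len_cat avs (ltnW vj); lra.
right; move: best; rewrite (min_idPr (ltW qp)) le_min => /andP[pp pq'].
have jv : (j <= vs)%N.
  rewrite leqNgt; apply/negP => vj; have := len_cat avs (ltnW vj).
  by have := len_gt0 vj; lra.
have hL : len i a - len a j <= rhoL i j.
  have := exL; have := rhoL_triangle i j a; rewrite (rhoL_sym j a).
  by have := le_trans (rhoL_le a j) (D_le_len aj); lra.
have [ui|iu] := leqP us i.
  have := exact_sub gs exs ui (geo_le g) jv; rewrite (len_cat ia aj).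
  by have := len_ge0 i a; have := len_ge0 a j; lra.
have := exact_sub gs exs (leqnn _) (leq_trans usa aj) jv; rewrite (len_cat usa aj).
have := rho_triangle us i j; rewrite (rho_sym us i).
have := le_trans (rho_le i us) (D_le_len (ltnW iu)).
by have := len_cat (ltnW iu) usa; lra.
Qed.

End Pin.

Lemma best_block lo a hi : (lo <= a)%N -> (a <= hi)%N -> exists p : nat * nat,
  [/\ (lo <= p.1 <= a)%N, (a <= p.2 <= hi)%N, geo p.1 p.2 &
      forall i j, (lo <= i <= a)%N -> (a <= j <= hi)%N -> geo i j ->
       Num.min (len i a) (len a j) <= Num.min (len p.1 a) (len a p.2)].
Proof.
move=> la ah.
pose P := [pred p : 'I_hi.+1 * 'I_hi.+1 | [&& (lo <= p.1 <= a)%N, (a <= p.2)%N & geo p.1 p.2]].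
have aH : (a < hi.+1)%N by [].
pose a0 : 'I_hi.+1 := Ordinal aH.
have Pa : P (a0, a0) by rewrite /= la leqnn geo_refl.
case: (arg_maxP (fun p : 'I_hi.+1 * 'I_hi.+1 => Num.min (len p.1 a) (len a p.2)) Pa)
  => -[p1 p2] /and3P[/= H1 H2 H3] H4.
exists (nat_of_ord p1, nat_of_ord p2); split => //=; first by rewrite H2 leq_ord.
move=> i j Hi /andP[aj jh] gij.
have ih : (i < hi.+1)%N by case/andP: Hi => _ /leq_trans; apply.
have jh' : (j < hi.+1)%N by [].
by apply: (H4 (Ordinal ih, Ordinal jh')); rewrite /= Hi aj gij.
Qed.

(** The greedy choice always advances by one step below [m], since a single edge may fail to be a
    shortest path. *)
Definition next_pin a := maxn (minn a.+1 m) (\max_(j < m.+1 | geo a j) j).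
Definition pin k := iter k next_pin 0%N.

Lemma next_pin_le a : (next_pin a <= m)%N.
Proof.
rewrite /next_pin geq_max geq_minr; apply/bigmax_leqP => j _.
exact: leq_ord.
Qed.

Lemma next_pin_max a j : geo a j -> (j <= m)%N -> (j <= next_pin a)%N.
Proof.
move=> g jm; have jm' : (j < m.+1)%N by [].
apply: leq_trans (leq_maxr _ _).
exact: (@leq_bigmax_cond _ _ (fun j : 'I_m.+1 => nat_of_ord j) (Ordinal jm')).
Qed.

Lemma next_pin_ge a : (a <= m)%N -> (a <= next_pin a)%N.
Proof. by move=> am; apply: next_pin_max am; exact: geo_refl. Qed.

Lemma next_pin_gt a : (a < m)%N -> (a < next_pin a)%N.
Proof. by move=> am; rewrite /next_pin leq_max leq_min ltnSn am. Qed.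

Lemma next_pin_geo a : (a <= m)%N -> geo a (next_pin a) \/ (next_pin a <= a.+1)%N.
Proof.
move=> am; rewrite /next_pin; case: (leqP (minn a.+1 m) (\max_(j < m.+1 | geo a j) j)) => H.
  left; have am' : (a < m.+1)%N by [].
  have g0 : geo a (Ordinal am') by exact: geo_refl.
  by rewrite (@bigop.bigmax_eq_arg _ (Ordinal am') (fun x : 'I_m.+1 => geo a x) (fun x : 'I_m.+1 => nat_of_ord x) g0); case: arg_maxnP.
by right; exact: geq_minl.
Qed.

Lemma pin_le k : (pin k <= m)%N.
Proof. by case: k => //= k; exact: next_pin_le. Qed.

Lemma pinS k : pin k.+1 = next_pin (pin k).
Proof. by []. Qed.

Lemma pin_mono : {homo pin : i j / (i <= j)%N}.
Proof. by apply: homo_leq => // [j i k|k]; [exact: leq_trans|exact: next_pin_ge (pin_le k)]. Qed.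

Lemma pin_ge k : (minn k m <= pin k)%N.
Proof.
elim: k => [|k IH]; first by rewrite min0n.
have [km|mk] := ltnP (pin k) m.
  by have := next_pin_gt km; rewrite -pinS; lia.
by have := next_pin_ge (pin_le k); rewrite -pinS; lia.
Qed.

Lemma pin_find i : (i < m)%N -> exists k, (pin k <= i < pin k.+1)%N.
Proof.
move=> im; have ex : exists k, (pin k <= i)%N by exists 0%N.
have ub k : (pin k <= i)%N -> (k <= i)%N by have := pin_ge k; lia.
case: (ex_maxnP ex ub) => k ki kmax; exists k; rewrite ki ltnNge.
by apply/negP => /kmax; rewrite ltnn.
Qed.

Theorem line_families : exists fam : nat -> nat -> nat,
  [/\ forall f, {homo fam f : i j / (i <= j)%N},
      forall f k, (fam f k <= fam f 0%N + m)%N &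
      forall rho : nat -> nat -> nat -> R,
       (forall f i j k, rho f i k <= rho f i j + rho f j k) ->
       (forall f i j, rho f i j = rho f j i) ->
       (forall f i j, 0 <= rho f i j <= D i j) ->
       (forall f k, D (fam f k) (fam f k.+1) <= rho f (fam f k) (fam f k.+1)) ->
       forall i j, (i < m)%N -> geo i j -> D i j / 2 <= \sum_(f < 6) rho f i j].
Proof.
have pinS_le k : (pin k <= pin k.+1)%N by exact: pin_mono.
have [ctr ctrP] := choice (fun k => best_block (pinS_le k) (pinS_le k.+1)).
have [c0 [c01 c02 c0g c0P]] := best_block (leq0n m) (leq_addr m m).
have exL : exists u, geo u m by exists m; exact: geo_refl.
pose uL := ex_minn exL.
have [uLg uLmin] : geo uL m /\ forall u, geo u m -> (uL <= u)%N.
  by rewrite /uL; case: ex_minnP.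
have exR : exists v, geo m v by exists m; exact: geo_refl.
have [vRg vRmax] : geo m (ex_maxn exR (@geo_window m)) /\
    forall v, geo m v -> (v <= ex_maxn exR (@geo_window m))%N by case: ex_maxnP.
move: (ex_maxn _ _) vRg vRmax => vR vRg vRmax.
pose two u v k := if k is 0%N then u else v : nat.
(* The end points of the balanced arcs around every second pin. The arc [ctr k] stays between
   [pin k] and [pin k.+2], so arcs of one parity do not overlap. *)
pose B c k := let p := ctr (k./2.*2 + c)%N in if odd k then p.2 else p.1.
(* Families 3 and 4 pin the longest geodesic arcs ending and starting at the base point [m]; family
   5 pins the best balanced arc around it. *)
pose fam f := match f with
  | 0 => pin | 1 => B 0%N | 2 => B 1%N | 3 => two uL m | 4 => two m vR
  | _ => two c0.1 c0.2 end%N.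
have B_mono c : {homo B c : i j / (i <= j)%N}.
  apply: homo_leq => // [j i k|k]; first exact: leq_trans.
  rewrite /B /=; have [ok|ek] := boolP (odd k) => /=.
    have [_ /andP[_ H1] _ _] := ctrP (k./2.*2 + c)%N.
    have -> : ((uphalf k).*2 + c = (k./2.*2 + c).+2)%N by rewrite uphalf_half ok; clear; lia.
    by have [/andP[H2 _] _ _ _] := ctrP (k./2.*2 + c).+2; apply: leq_trans H1 H2.
  rewrite uphalf_half (negPf ek) add0n.
  by have [_ _ /geo_le] := ctrP (k./2.*2 + c)%N.
have two_mono u v : (u <= v)%N -> {homo two u v : i j / (i <= j)%N}.
  by move=> uv [|i] [|j].
have B_le c k : (B c k <= m)%N.
  rewrite /B; have [/andP[_ H1] /andP[_ H2] _ _] := ctrP (k./2.*2 + c)%N.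
  by case: odd; [apply: leq_trans H2 _|apply: leq_trans H1 _]; exact: pin_le.
exists fam; split.
- move=> [|[|[|[|[|f]]]]] /=; [exact: pin_mono|exact: B_mono|exact: B_mono| | |]; apply: two_mono.
  + exact: geo_le uLg.
  + exact: geo_le vRg.
  + exact: geo_le c0g.
- move=> [|[|[|[|[|f]]]]] k /=.
  + by rewrite add0n pin_le.
  + by apply: leq_trans (B_le _ _) (leq_addl _ _).
  + by apply: leq_trans (B_le _ _) (leq_addl _ _).
  + by case: k => [|k] /=; [exact: leq_addr|exact: leq_addl].
  + by case: k => [|k] /=; [exact: leq_addr|exact: geo_window vRg].
  + by case: k => [|k] /=; [exact: leq_addr|exact: geo_window c0g].
move=> rho rT rS rB ex i j im g.
have r0 f u v : 0 <= rho f u v by case/andP: (rB f u v).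
have rD f u v : rho f u v <= D u v by case/andP: (rB f u v).
have S6 : \sum_(f < 6) rho f i j = rho 0%N i j + rho 1%N i j + rho 2%N i j + rho 3%N i j + rho 4%N i j + rho 5%N i j.
  by rewrite !big_ord_recr big_ord0 /= add0r.
have := (r0 0%N i j, r0 1%N i j, r0 2%N i j, (r0 3%N i j, r0 4%N i j, r0 5%N i j)).
move=> [[[p0 p1] p2] [[p3 p4] p5]].
(* Between consecutive pins family 0 is exact on geodesic pieces: the interval is geodesic or at
   most one step long. *)
have exA k u v : (pin k <= u)%N -> (u <= v)%N -> (v <= pin k.+1)%N -> geo u v ->
    len u v <= rho 0%N u v.
  move=> ku uv vk guv; have [gk|sk] := next_pin_geo (pin_le k).
    exact: (exact_sub (rT 0%N) (rD 0%N) gk (ex 0%N k)).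
  have [<-|uv'] := eqVneq u v; first by rewrite /len big_geq.
  rewrite -pinS in sk.
  have [uE vE] : u = pin k /\ v = pin k.+1 by move: uv' ku uv vk sk; clear; lia.
  by rewrite -(geoE guv) uE vE; exact: (ex 0%N k).
have [mj|jm] := ltnP m j.
  have im' := ltnW im; have mj' := ltnW mj.
  have exL' : len i m <= rho 3%N i m.
    apply: (exact_sub (rT 3%N) (rD 3%N) uLg (ex 3%N 0%N)) => //.
    by apply: uLmin; exact: geo_sub g _ _ _.
  have exR' : len m j <= rho 4%N m j.
    apply: (exact_sub (rT 4%N) (rD 4%N) vRg (ex 4%N 0%N)) => //.
    by apply: vRmax; exact: geo_sub g _ _ _.
  have j2 : (j <= m + m)%N by move: (geo_window g) im; clear; lia.
  have [/andP[_ cm] /andP[mc _]] := (c01, c02).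
  have [||] := pin_bound (rT 5%N) (rS 5%N) (rD 5%N) (rT 3%N) (rS 3%N) (rD 3%N)
    (rT 4%N) (rS 4%N) (rD 4%N) (r0 5%N) c0g cm mc (ex 5%N 0%N) g im' mj' _ exL' exR'.
  - by apply: c0P; rewrite ?im' ?mj'.
  - lra.
  - lra.
have [k /andP[ki ik]] := pin_find im.
have ij := geo_le g.
have [jk|kj] := leqP j (pin k.+1).
  have := exA k i j ki ij jk g; rewrite -(geoE g).
  have : 0 <= D i j by rewrite (geoE g) len_ge0.
  lra.
have ik' := ltnW ik; have kj' := ltnW kj.
have g1 : geo i (pin k.+1) by exact: geo_sub g _ _ _.
have g2 : geo (pin k.+1) j by exact: geo_sub g _ _ _.
(* The greedy choice keeps a geodesic arc that starts at a pin from passing the next pin. *)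
have jk2 : (j <= pin k.+2)%N by exact: next_pin_max.
have e1 := exA k _ _ ki ik' (leqnn _) g1.
have e2 := exA k.+1 _ _ (leqnn _) kj' jk2 g2.
have [/andP[_ c1] /andP[c2 _] cg cP] := ctrP k.
have cbest : Num.min (len i (pin k.+1)) (len (pin k.+1) j) <=
    Num.min (len (ctr k).1 (pin k.+1)) (len (pin k.+1) (ctr k).2).
  by apply: cP; rewrite ?ki ?kj'.
(* In the family of the parity of [k], the breaks numbered [k./2.*2] and its successor are the ends
   of [ctr k]. *)
have Bk f : (forall k', B (odd k) k' = fam f k') -> D (ctr k).1 (ctr k).2 <= rho f (ctr k).1 (ctr k).2.
  move=> Bf; have := ex f k./2.*2; rewrite -!Bf /B /= odd_double /= doubleK uphalf_double addnC odd_double_half.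
  by [].
case ok: (odd k) Bk => Bk.
  have := pin_bound (rT 2%N) (rS 2%N) (rD 2%N) (rT 0%N) (rS 0%N) (rD 0%N)
    (rT 0%N) (rS 0%N) (rD 0%N) (r0 2%N) cg c1 c2 (Bk 2%N _) g ik' kj' cbest e1 e2.
  by case/(_ (fun=> erefl)); lra.
have := pin_bound (rT 1%N) (rS 1%N) (rD 1%N) (rT 0%N) (rS 0%N) (rD 0%N)
    (rT 0%N) (rS 0%N) (rD 0%N) (r0 1%N) cg c1 c2 (Bk 1%N _) g ik' kj' cbest e1 e2.
by case/(_ (fun=> erefl)); lra.
Qed.

End Line.

(** * Simple face walks and the packing of geodesic arcs *)

Lemma perm_porbit_connect (T : finType) (s : {perm T}) x y :
  fconnect s x y -> y \in porbit s x.
Proof.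
by move=> /iter_findex <-; apply/porbitP; exists (findex s x y); rewrite permX.
Qed.

(* Cutting a face boundary walk at a repeated vertex produces two closed walks;
   the rearrangement with the largest number of orbits has no repetition left. *)
Lemma simple_face_walks (G : sgraph) (M : planar_embedding G) :
  exists psi : dart G -> dart G,
   [/\ injective psi, forall d, dart_src (psi d) = dart_tgt d,
       forall d, fconnect (next_on_face (rot M)) d (psi d) &
       forall d d', fconnect psi d d' -> dart_src d = dart_src d' -> d = d'].
Proof.
pose phi := next_on_face (rot M).
pose P := [pred s : {perm dart G} | [forall d, (dart_src (s d) == dart_tgt d) && fconnect phi d (s d)]].
have Pphi : P (perm (@phi_inj _ M)).
  by apply/forallP => d; rewrite permE phi_src eqxx fconnect1.
case: (arg_maxnP (fun s : {perm dart G} => #|porbits s|) Pphi) => s /forallP Ps smax.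
have s_src d : dart_src (s d) = dart_tgt d by case/andP: (Ps d) => /eqP.
have s_face d : fconnect phi d (s d) by case/andP: (Ps d).
exists s; split => //; first exact: perm_inj.
move=> x y xy sxy; apply/eqP; apply: contraT => nxy.
pose x' := (s^-1)%g x; pose y' := (s^-1)%g y.
have sx : s x' = x by rewrite permKV.
have sy : s y' = y by rewrite permKV.
have x'y' : x' != y' by rewrite (inj_eq perm_inj).
have sI : injective s by exact: perm_inj.
have cxy : fconnect s y' x'.
  rewrite (fconnect_sym sI); apply: connect_trans (connect_trans _ xy) _.
    by rewrite -sx fconnect1.
  by rewrite (fconnect_sym sI) -sy fconnect1.
have tt' : dart_tgt x' = dart_tgt y' by rewrite -!s_src sx sy.
(* The transposition exchanges the successors of [x'] and [y'], which have the same target; as both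
   lie on one orbit, that orbit splits in two, against maximality. *)
have /smax : P (tperm x' y' * s)%g.
  apply/forallP => d; rewrite permM.
  case: tpermP => [->|->|_ _].
  - rewrite s_src tt' eqxx /=; apply: connect_trans (s_face y').
    rewrite (fconnect_sym (@phi_inj _ M)); exact: psi_face_connect cxy.
  - rewrite s_src tt' eqxx /=; apply: connect_trans (s_face x').
    exact: psi_face_connect cxy.
  - by rewrite s_src eqxx s_face.
have := porbits_mul_tperm s x' y'; rewrite /= (perm_porbit_connect cxy) x'y' /= addn0 => -> .
by rewrite addn1 ltnn.
Qed.

Section SepMetric.
Variables (R : realType) (G : sgraph) (y : {set G} -> R).
Hypothesis y_ge0 : forall S, 0 <= y S.
(** The cut pseudometric with weights [y]. *)
Definition rho (u v : G) := \sum_S y S * (sep S u v)%:R.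

Lemma rho_triangle u v z : rho u z <= rho u v + rho v z.
Proof.
rewrite /rho -big_split; apply: ler_sum => S _ /=; rewrite -mulrDr ler_wpM2l //.
by rewrite (sep_trans _ _ v); case: (sep S u v); case: (sep S v z); rewrite /= ?addr0 ?add0r // addr_ge0 ?ler01.
Qed.

Lemma rho_sym u v : rho u v = rho v u.
Proof. by apply: eq_bigr => S _; rewrite sepC. Qed.

Lemma rho_ge0 u v : 0 <= rho u v.
Proof. by apply: sumr_ge0 => S _; rewrite mulr_ge0 // ler0n. Qed.

Lemma rho_xx u : rho u u = 0.
Proof. by rewrite /rho big1 // => S _; rewrite sep_xx mulr0. Qed.

Lemma rho_le_dist (l : G -> G -> R) :
  (forall u v : G, adj u v -> l u v = l v u) -> (forall u v : G, adj u v -> 0 < l u v) ->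
  (forall d : dart G, \sum_S y S * (d \in cut S)%:R <= graph_dist l (dart_src d) (dart_tgt d)) ->
  forall u v, reach u v -> rho u v <= graph_dist l u v.
Proof.
move=> l_sym l_pos le u v r; apply: le_dist => // p; elim: p u {r} => [|z p IH] u.
  by rewrite /walk /= => /eqP ->; rewrite rho_xx walk_length_nil.
rewrite /walk /= => /andP[/andP[uz pz] lz]; rewrite walk_length_cons.
apply: le_trans (rho_triangle u z v) _; apply: lerD; last by apply: IH; rewrite /walk pz.
apply: le_trans (dist_adj l_pos uz).
have := le (exist _ (u, z) uz : dart G); apply: le_trans.
by rewrite le_eqVlt; apply/orP; left; apply/eqP/eq_bigr => S _; rewrite cut_mem.
Qed.

End SepMetric.

Lemma iter_order_inj (T : finType) (psi : T -> T) o p q : injective psi ->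
  (p <= q)%N -> (q - p < fingraph.order psi o)%N -> iter p psi o = iter q psi o -> p = q.
Proof.
move=> psi_inj pq lt; rewrite -{1}(subnKC pq) iterD => /(iter_injective psi_inj) e.
by have := findex_iter lt; rewrite -e findex0 => /esym/eqP; rewrite subn_eq0 => qp; lia.
Qed.

(** * Break points on all orbits and averaging *)

Section Families.
Variables (R : realType) (G : sgraph) (M : planar_embedding G) (l : G -> G -> R).
Hypothesis l_sym : forall u v : G, adj u v -> l u v = l v u.
Hypothesis l_pos : forall u v : G, adj u v -> 0 < l u v.
Local Notation dist := (graph_dist l).
Local Notation phi := (next_on_face (rot M)).
Local Notation T := (dart G).
Variable psi : T -> T.
Hypothesis psi_inj : injective psi.
Hypothesis psi_src : forall d, dart_src (psi d) = dart_tgt d.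
Hypothesis psi_face : forall d, fconnect phi d (psi d).
Implicit Types (d o : T) (S : {set G}).

Definition corner o i := dart_src (iter i psi o).

Lemma froot_iter o i : froot psi (iter i psi o) = froot psi o.
Proof.
by apply/esym/eqP; rewrite (root_connect (fconnect_sym psi_inj)) fconnect_iter.
Qed.

Lemma froot_psi d : froot psi (psi d) = froot psi d.
Proof. exact: (froot_iter d 1). Qed.

(** One packing serves all orbits, each with breaks counted from its root. The breaks stay within
    one turn, so successive terms of a sequence are successive breaks of the orbit. *)
Lemma family_packing (b : T -> nat -> nat) :
  (forall o, {homo b o : i j / (i <= j)%N}) ->
  (forall o k, (b o k <= b o 0%N + fingraph.order psi o)%N) ->
  exists y : {set G} -> R,
  [/\ forall S, 0 <= y S, forall S, ~~ bond S -> y S = 0,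
      forall d, \sum_S y S * (d \in cut S)%:R <= dist (dart_src d) (dart_tgt d) &
      forall o k, froot psi o = o ->
        dist (corner o (b o k)) (corner o (b o k.+1)) <=
        rho y (corner o (b o k)) (corner o (b o k.+1))].
Proof.
move=> b_mono b_win.
pose B := [set d | `[< exists k, d = iter (b (froot psi d) k) psi (froot psi d) >]].
have BP o k : froot psi o = o -> iter (b o k) psi o \in B.
  by move=> ro; rewrite inE; apply/asboolP; exists k; rewrite froot_iter ro.
have fsym := fconnect_sym psi_inj.
have B_meets d : exists k, iter k.+1 psi d \in B.
  set o := froot psi d; have ro : froot psi o = o by exact: root_root.
  have : fconnect psi (psi d) (iter (b o 0%N) psi o).
    by rewrite -(root_connect fsym) froot_psi froot_iter ro.
  move/iter_findex => e; exists (findex psi (psi d) (iter (b o 0%N) psi o)).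
  by rewrite iterSr e; exact: BP.
have [y [y0 yb yd yc]] := bond_packing l_sym l_pos psi_inj psi_src psi_face B_meets.
exists y; split => // o k ro.
(* Repeated terms of the sequence give equal corners at distance 0. *)
have := b_mono o _ _ (leqnSn k); rewrite leq_eqVlt => /predU1P[->|lt].
  by rewrite dist0 // rho_ge0.
have [n nE] : exists n, b o k.+1 = (n.+1 + b o k)%N by exists (b o k.+1 - b o k).-1; lia.
have := yc (iter (b o k) psi o) n; rewrite -iterD -nE; apply; [exact: BP|exact: BP|].
move=> i /andP[i0 ik]; rewrite -iterD inE; apply/asboolPn => -[j].
rewrite froot_iter ro => e.
have w0 := b_mono o _ _ (leq0n k); have wj := b_mono o _ _ (leq0n j).
have w1 := b_win o k.+1; have w2 := b_win o j.
have ji : b o j = (i + b o k)%N.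
  have [le|le] := leqP (i + b o k) (b o j).
    by apply/esym; apply: (iter_order_inj psi_inj le _ e); lia.
  by apply: (iter_order_inj psi_inj (ltnW le) _ (esym e)); lia.
have [jk|kj] := leqP j k; first by have := b_mono o _ _ jk; lia.
by have := b_mono o _ _ kj; lia.
Qed.

Lemma reach_corner o i j : reach (corner o i) (corner o j).
Proof.
by apply: (reach_psi psi_src); rewrite -(root_connect (fconnect_sym psi_inj)) !froot_iter.
Qed.

Lemma corner_adj o i : adj (corner o i) (corner o i.+1).
Proof. by rewrite /corner /= psi_src; exact: valP (iter i psi o). Qed.

Lemma corner_dist_le o i j : (i <= j)%N ->
  dist (corner o i) (corner o j) <= len (fun t => l (corner o t) (corner o t.+1)) i j.
Proof.
move=> /subnKC <-; elim: (j - i)%N => [|n IH].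
  by rewrite addn0 dist0 // /len big_geq.
rewrite addnS /len big_nat_recr ?leq_addr //=.
apply: le_trans (dist_triangle l_pos (reach_corner _ _ (i + n)) (reach_corner _ _ _)) _.
by apply: lerD => //; apply: dist_adj => //; exact: corner_adj.
Qed.

(** The average of the six packings; the constant is 12 = 2 * 6 because their sum keeps half of
    every geodesic arc. *)
Theorem geodesic_arcs : exists y : {set G} -> R,
  [/\ forall S, 0 <= y S, forall S, ~~ bond S -> y S = 0,
      forall d, \sum_S y S * (d \in cut S)%:R <= dist (dart_src d) (dart_tgt d) &
      forall d k, dist (dart_src d) (corner d k) =
          \sum_(t < k) l (corner d t) (corner d t.+1) ->
        dist (dart_src d) (corner d k) / 12 <= rho y (dart_src d) (corner d k)].
Proof.
pose D o i j := dist (corner o i) (corner o j).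
pose L o t := l (corner o t) (corner o t.+1).
have per o i : corner o (i + fingraph.order psi o) = corner o i.
  by rewrite /corner iterD (iter_order psi_inj).
have m0 o : (0 < fingraph.order psi o)%N by exact: fingraph.order_gt0.
have DT o i j k : D o i k <= D o i j + D o j k.
  by apply: dist_triangle => //; exact: reach_corner.
have L0 o t : 0 < L o t by apply: l_pos; exact: corner_adj.
have Dw o i : D o i (i + fingraph.order psi o)%N = 0 by rewrite /D per dist0.
have D0 o i : D o i i = 0 by exact: dist0.
have [fam famP] := choice (fun o => line_families (m0 o) (DT o) (L0 o) (Dw o) (@corner_dist_le o) (D0 o)).
have fam1 f o : {homo fam o f : i j / (i <= j)%N} by case: (famP o).
have fam2 f o k : (fam o f k <= fam o f 0%N + fingraph.order psi o)%N by case: (famP o).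
have [ys ysP] := choice (fun f => family_packing (fam1 f) (fam2 f)).
exists (fun S => (\sum_(f < 6) ys f S) / 6); split.
- by move=> S; rewrite divr_ge0 ?ler0n // sumr_ge0 // => f _; have [H _ _ _] := ysP f; exact: H.
- move=> S nS; rewrite big1 ?mul0r // => f _; have [_ H _ _] := ysP f; exact: H.
- move=> d.
  have -> : \sum_S (\sum_(f < 6) ys f S) / 6 * (d \in cut S)%:R =
      (\sum_(f < 6) \sum_S ys f S * (d \in cut S)%:R) / 6.
    rewrite exchange_big mulr_suml; apply: eq_bigr => S _ /=.
    by rewrite -mulr_suml mulrAC.
  rewrite ler_pdivrMr ?ltr0n //.
  apply: (@le_trans _ _ (\sum_(f < 6) dist (dart_src d) (dart_tgt d))).
    by apply: ler_sum => f _; have [_ _ H _] := ysP f; exact: H.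
  by rewrite !big_ord_recr big_ord0 /=; lra.
move=> d k geod; set o := froot psi d.
have fsym := fconnect_sym psi_inj.
have ro : froot psi o = o by exact: root_root.
have cod : fconnect psi o d by rewrite fsym connect_root.
set i := findex psi o d.
have im : (i < fingraph.order psi o)%N by exact: findex_max.
have cE t : corner d t = corner o (i + t) by rewrite /corner addnC iterD iter_findex.
have dE : dart_src d = corner o i by rewrite -[dart_src d]/(corner d 0) cE addn0.
have sE (F : nat -> R) : \sum_(i <= t < i + k) F t = \sum_(t < k) F (i + t)%N.
  rewrite -{1}[i]add0n big_addn addKn big_mkord.
  by apply: eq_bigr => t _; rewrite addnC.
have g : geo (D o) (L o) i (i + k).
  rewrite /geo leq_addr /D -cE -dE geod /len sE.
  by apply/eqP/eq_bigr => t _; rewrite /L -addnS !cE.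
have [_ _ H] := famP o.
have := H (fun f u v => rho (ys f) (corner o u) (corner o v)) _ _ _ _ i (i + k)%N im g.
have rE : rho (fun S => (\sum_(f < 6) ys f S) / 6) (corner o i) (corner o (i + k)) =
   (\sum_(f < 6) rho (ys f) (corner o i) (corner o (i + k))) / 6.
  rewrite /rho exchange_big mulr_suml; apply: eq_bigr => S _ /=.
  by rewrite -mulr_suml mulrAC.
rewrite cE dE rE; move=> H'.
have {}H' : D o i (i + k)%N / 2 <= \sum_(f < 6) rho (ys f) (corner o i) (corner o (i + k)).
  apply: H' => [f u v z|f u v|f u v|f t].
  - by apply: rho_triangle; have [? _ _ _] := ysP f.
  - exact: rho_sym.
  - have [y0 _ yd _] := ysP f; rewrite rho_ge0 //=.
    by apply: rho_le_dist => //; exact: reach_corner.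
  - by have [_ _ _ yc] := ysP f; exact: yc.
by rewrite /D in H'; lra.
Qed.

End Families.

(** * Geodesic paths on a face boundary *)

Section FacePaths.
Variables (R : realType) (G : sgraph) (M : planar_embedding G) (l : G -> G -> R).
Hypothesis l_sym : forall u v : G, adj u v -> l u v = l v u.
Hypothesis l_pos : forall u v : G, adj u v -> 0 < l u v.
Local Notation dist := (graph_dist l).
Local Notation phi := (next_on_face (rot M)).
Local Notation T := (dart G).
Variable psi : T -> T.
Hypothesis psi_inj : injective psi.
Hypothesis psi_src : forall d, dart_src (psi d) = dart_tgt d.
Hypothesis psi_face : forall d, fconnect phi d (psi d).
Hypothesis psi_simple : forall d d', fconnect psi d d' -> dart_src d = dart_src d' -> d = d'.
Implicit Types (d o f : T) (S : {set G}) (u v x z : G) (p q : seq G).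

Let fsym := fconnect_sym psi_inj.

(* A bond meets a face in at most two darts and every closed walk evenly, so
   on each face it stays inside one of the simple closed walks. *)
Lemma bond_one_orbit S d1 d3 : bond S -> d1 \in cut S -> d3 \in cut S ->
  froot phi d3 = froot phi d1 -> froot psi d3 = froot psi d1.
Proof.
move=> bS c1 c3 e3.
have [d2 [c2 n2 e2]] : exists d2, [/\ d2 \in cut S, d2 != d1 & froot psi d2 = froot psi d1].
  have := cut_orbit_even S (froot psi d1) psi_inj psi_src; rewrite (bigD1 d1) //= eqxx /=.
  move=> /negbFE.
  case: (pselect (exists d2, [/\ d2 \in cut S, d2 != d1 & froot psi d2 = froot psi d1])) => // no.
  rewrite big1 // => d /andP[dS dd1]; apply/negbTE/negP => /eqP e.
  by apply: no; exists d.
have e2' : froot phi d1 = froot phi d2.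
  by apply: (psi_face_root psi_face); rewrite -(root_connect fsym) e2.
have [|->|->] // := bond_face (M := M) bS c1 c2 c3 e2' (esym e3).
by rewrite eq_sym.
Qed.

Lemma val_dart d a b : val d = (a, b) -> dart_src d = a /\ dart_tgt d = b.
Proof. by move=> e; rewrite /dart_src /dart_tgt e. Qed.

Lemma val_dart_rev d a b : val (dart_rev d) = (a, b) -> dart_tgt d = a /\ dart_src d = b.
Proof. exact: (@val_dart (dart_rev d)). Qed.

Definition on_orbit o (e : G * G) :=
  [exists d : T, (froot psi d == o) && ((val d == e) || (val (dart_rev d) == e))].

Lemma on_orbitP o e : reflect
  (exists2 d, froot psi d = o & val d = e \/ val (dart_rev d) = e) (on_orbit o e).
Proof.
apply: (iffP existsP) => -[d].
  by case/andP => /eqP dO /orP[/eqP|/eqP] de; exists d => //; [left|right].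
by move=> dO [de|de]; exists d; rewrite dO de !eqxx ?orbT.
Qed.

Lemma edge_on_faceP f e : edge_on_face M f e ->
  exists2 d, froot phi d = froot phi f & val d = e \/ val (dart_rev d) = e.
Proof.
case: e => a b; rewrite /edge_on_face /face_boundary /= => /orP[] /mapP[d].
all: rewrite -fconnect_orbit -(root_connect (fconnect_sym (@phi_inj _ M))) => /eqP fd de.
  by exists d => //; left.
exists d => //; right; have [sE tE] := val_dart (esym de).
by rewrite -sE -tE.
Qed.

Lemma on_orbit_ends o a b : on_orbit o (a, b) ->
  (exists2 d, froot psi d = o & dart_src d = a) /\ (exists2 d, froot psi d = o & dart_src d = b).
Proof.
case/on_orbitP => d dO [|] de.
  have [sE tE] := val_dart de.
  by split; [exists d|exists (psi d); rewrite ?froot_psi // psi_src].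
have [tE sE] := val_dart_rev de.
by split; [exists (psi d); rewrite ?froot_psi // psi_src|exists d].
Qed.

Lemma walk_edges_cons u z p : walk_edges u (z :: p) = (u, z) :: walk_edges z p.
Proof. by []. Qed.

Lemma walk_edges_cat u p q :
  walk_edges u (p ++ q) = walk_edges u p ++ walk_edges (last u p) q.
Proof. by elim: p u => [|z p IH] u //=; rewrite walk_edges_cons IH. Qed.

Lemma last_edge u z q : (last u (belast z q), last z q) \in walk_edges u (z :: q).
Proof.
elim: q u z => [|a q IH] u z; first by rewrite mem_head.
by rewrite walk_edges_cons in_cons IH orbT.
Qed.

Lemma walk_split (P : pred (G * G)) u p : exists q p2, [/\ p = q ++ p2,
  all P (walk_edges u q) & (if p2 is z :: _ then ~~ P (last u q, z) else true)].
Proof.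
elim: p u => [|z p IH] u; first by exists [::], [::].
have [Puz|nP] := boolP (P (u, z)); last by exists [::], (z :: p).
have [q [p2 [-> H1 H2]]] := IH z.
by exists (z :: q), p2; split => //=; rewrite Puz.
Qed.

Lemma cut_edge_face S f e d : edge_on_face M f e -> val d = e -> d \in cut S ->
  exists2 d', d' \in cut S & froot phi d' = froot phi f /\ (val d' = e \/ val (dart_rev d') = e).
Proof.
move=> /edge_on_faceP[d' fd' de] ed dS; exists d' => //.
case: de => de; first by rewrite (_ : d' = d) //; apply/val_inj; rewrite de ed.
by rewrite -cut_rev (_ : dart_rev d' = d) //; apply/val_inj; rewrite de ed.
Qed.

Lemma cut_edge_orbit S o e d : on_orbit o e -> val d = e -> d \in cut S ->
  exists2 d', d' \in cut S & froot psi d' = o.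
Proof.
move=> /on_orbitP[d' fd' de] ed dS; exists d' => //.
case: de => de; first by rewrite (_ : d' = d) //; apply/val_inj; rewrite de ed.
by rewrite -cut_rev (_ : dart_rev d' = d) //; apply/val_inj; rewrite de ed.
Qed.

Lemma orbit_cut S d d' : fconnect psi d d' -> sep S (dart_src d) (dart_src d') ->
  exists2 d1, d1 \in cut S & froot psi d1 = froot psi d.
Proof.
move=> /iter_findex <-; elim: (findex _ _ _) => [|n IH] /=; first by rewrite sep_xx.
rewrite psi_src (sep_trans _ _ (dart_src (iter n psi d))).
case nS: (sep S (dart_src d) _) => /= H; first exact: IH.
by exists (iter n psi d); rewrite ?cut_mem // froot_iter.
Qed.

(** Otherwise a bond separating the two ends crosses both the orbit and the walk; being confined to
    one orbit of the face, it crosses the walk in an edge of that orbit. *)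
Lemma no_return f o x z q : froot phi o = froot phi f ->
  (exists2 d, froot psi d = froot psi o & dart_src d = x) ->
  (exists2 d, froot psi d = froot psi o & dart_src d = z) ->
  walk x z q -> all (edge_on_face M f) (walk_edges x q) ->
  all (predC (on_orbit (froot psi o))) (walk_edges x q) -> x = z.
Proof.
move=> fo [dx dxo <-] [dz dzo <-] wq fq nq; apply/eqP; apply: contraT => xz.
have cxz : fconnect psi dx dz by rewrite -(root_connect fsym) dxo dzo.
have [S bS sS] := bond_sep (reach_psi psi_src cxz) xz.
have [d1 c1 e1] := orbit_cut cxz sS.
have [d dS dq] := walk_cut wq sS.
have [d3 c3 [f3 e3]] := cut_edge_face (allP fq _ dq) erefl dS.
have := allP nq _ dq; rewrite /= => /negP[]; apply/on_orbitP; exists d3 => //.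
rewrite (bond_one_orbit bS c1 c3) ?e1 //.
rewrite f3 -fo; apply/esym/(psi_face_root psi_face).
by rewrite -(root_connect fsym) e1 dxo.
Qed.

(** On a simple orbit only [psi d] leaves [z] and only [d] enters it, so a simple path that starts
    forward cannot turn back. *)
Lemma forward_arc o z q d : uniq (dart_src d :: z :: q) -> froot psi d = o -> dart_tgt d = z ->
  all (on_orbit o) (walk_edges z q) ->
  last z q = corner psi d (size q).+1 /\
  walk_length l (dart_src d) (z :: q) = \sum_(t < (size q).+1) l (corner psi d t) (corner psi d t.+1).
Proof.
elim: q z d => [|z2 q IH] z d.
  move=> _ _ dz _; rewrite /= walk_length_cons walk_length_nil addr0 big_ord_recl big_ord0 addr0.
  by rewrite /corner /= psi_src dz.
move=> uq dO dz; rewrite walk_edges_cons /= => /andP[/on_orbitP[d2 d2O e2] aq].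
have c2 : fconnect psi (psi d) d2 by rewrite -(root_connect fsym) (froot_psi psi_inj) dO d2O.
have d2E : psi d = d2 /\ dart_tgt d2 = z2.
  case: e2 => e2.
    have [sE tE] := val_dart e2.
    by split => //; apply: psi_simple => //; rewrite psi_src dz sE.
  have [tE sE] := val_dart_rev e2.
  have dd2 : d = d2.
    apply: psi_inj; apply: psi_simple; last by rewrite !psi_src dz tE.
    by apply: connect_trans c2 (fconnect1 _ _).
  by move: uq; rewrite dd2 sE /= !inE eqxx orbT.
have [pd tE] := d2E.
have [||||IH1 IH2] := IH z2 (psi d).
- by move: uq => /andP[_]; rewrite psi_src dz.
- by rewrite (froot_psi psi_inj).
- by rewrite pd.
- by [].
split; first by rewrite IH1 /corner -iterSr.
rewrite walk_length_cons -{2}dz -psi_src IH2 [RHS]big_ord_recl.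
by congr (_ + _); [rewrite /corner /= psi_src dz|apply: eq_bigr => t _; rewrite /corner -!iterSr].
Qed.

(** The path runs against [psi]; reversed, it is the forward arc from [d'], the dart crossed
    last. *)
Lemma backward_arc o z q d : uniq (dart_tgt d :: z :: q) -> froot psi d = o -> dart_src d = z ->
  all (on_orbit o) (walk_edges z q) ->
  exists d', [/\ last z q = dart_src d', psi d = iter (size q).+1 psi d' &
   walk_length l (dart_tgt d) (z :: q) = \sum_(t < (size q).+1) l (corner psi d' t) (corner psi d' t.+1)].
Proof.
have ldart (a : T) : l (dart_tgt a) (dart_src a) = l (dart_src a) (dart_tgt a).
  by apply/esym/l_sym; exact: valP a.
elim: q z d => [|z2 q IH] z d.
  move=> _ _ dz _; exists d; split => //; rewrite ?dz //.
  rewrite walk_length_cons walk_length_nil addr0 big_ord_recl big_ord0 addr0 -dz ldart.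
  by rewrite /corner /= psi_src.
move=> uq dO dz; rewrite walk_edges_cons /= => /andP[/on_orbitP[d2 d2O e2] aq].
have [pd sE] : psi d2 = d /\ dart_src d2 = z2.
  case: e2 => e2; last first.
    have [tE sE] := val_dart_rev e2.
    split => //; apply: psi_simple; last by rewrite psi_src dz tE.
    by rewrite -(root_connect fsym) (froot_psi psi_inj) dO d2O.
  have [sE tE] := val_dart e2.
  have dd2 : d = d2.
    by apply: psi_simple; rewrite ?dz ?sE // -(root_connect fsym) dO d2O.
  by move: uq; rewrite dd2 tE /= !inE eqxx orbT.
have t2 : dart_tgt d2 = z by rewrite -psi_src pd.
have [||d' [IH1 IH2 IH3]] := IH z2 d2 _ d2O sE.
- by move: uq => /andP[_]; rewrite t2.
- by [].
exists d'; split => //; first by rewrite -pd IH2.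
rewrite walk_length_cons -{2}t2 IH3 [RHS]big_ord_recr /= addrC; congr (_ + _).
have dE : iter (size q).+1 psi d' = d by rewrite -IH2.
rewrite -[corner psi d' (size q).+1]/(dart_src (iter (size q).+1 psi d')).
rewrite -[corner psi d' (size q).+2]/(dart_src (psi (iter (size q).+1 psi d'))).
by rewrite dE psi_src -ldart dz.
Qed.

Variable y : {set G} -> R.
Hypothesis y_ge0 : forall S, 0 <= y S.
Hypothesis y_bond : forall S, ~~ bond S -> y S = 0.
Hypothesis y_arc : forall d k, dist (dart_src d) (corner psi d k) =
    \sum_(t < k) l (corner psi d t) (corner psi d t.+1) ->
  dist (dart_src d) (corner psi d k) / 12 <= rho y (dart_src d) (corner psi d k).

Lemma orbit_path_bound o u z q : uniq (u :: z :: q) ->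
  all (on_orbit o) (walk_edges u (z :: q)) ->
  walk_length l u (z :: q) = dist u (last z q) ->
  dist u (last z q) / 12 <= rho y u (last z q).
Proof.
move=> uq; rewrite walk_edges_cons /= => /andP[/on_orbitP[d dO e] aq] wl.
case: e => e.
  have [sE tE] := val_dart e.
  rewrite -sE in uq wl *.
  have [lE lenE] := forward_arc uq dO tE aq.
  by rewrite lE; apply: y_arc; rewrite -lE -wl.
have [tE sE] := val_dart_rev e.
rewrite -tE in uq wl *.
have [d' [lE pE lenE]] := backward_arc uq dO sE aq.
have uE : dart_tgt d = corner psi d' (size q).+1 by rewrite /corner -pE psi_src.
rewrite (dist_sym l_sym l_pos) rho_sym lE uE; apply: y_arc.
by rewrite -uE -lE (dist_sym l_sym l_pos) -wl.
Qed.

(** Induction on the path, cutting off the longest prefix on one orbit. The two bounds add up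
    because no bond separates the ends of both parts. *)
Lemma face_path_bound f u p : uniq (u :: p) -> path (@adj G) u p ->
  all (edge_on_face M f) (walk_edges u p) ->
  walk_length l u p = dist u (last u p) ->
  dist u (last u p) / 12 <= rho y u (last u p).
Proof.
have [n] := ubnP (size p); elim: n u p => // n IH u [|z p] ltn uq pp fp wl.
  by rewrite /= dist0 // mul0r rho_ge0.
have := fp; rewrite {1}walk_edges_cons /= => /andP[/edge_on_faceP[d fd de] _].
rewrite [last _ _]/= in wl.
set o := froot psi d.
have oz : on_orbit o (u, z) by apply/on_orbitP; exists d.
have [q [p2 [pE qo p2o]]] := walk_split (on_orbit o) z p.
set x := last z q in p2o.
have lE : last z p = last x p2 by rewrite pE last_cat.
have qo' : all (on_orbit o) (walk_edges u (z :: q)) by rewrite walk_edges_cons /= oz.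
have fE : walk_edges u (z :: p) = walk_edges u (z :: q) ++ walk_edges x p2.
  by rewrite pE -cat_cons walk_edges_cat.
have wE : walk_length l u (z :: p) = walk_length l u (z :: q) + walk_length l x p2.
  by rewrite pE -cat_cons walk_length_cat.
move: fp; rewrite fE all_cat => /andP[fq fp2].
move: (pp); rewrite /= {1}pE cat_path andbA => /andP[/andP[uz pq] pp2].
have w1 : walk u x (z :: q) by rewrite /walk /= uz pq eqxx.
have w2 : walk x (last x p2) p2 by rewrite /walk pp2 eqxx.
have r1 : reach u x by exists (z :: q).
have r2 : reach x (last x p2) by exists p2.
have le1 := dist_le l_pos w1; have le2 := dist_le l_pos w2.
have le3 := dist_triangle l_pos r1 r2.
rewrite lE in wl *.
have wl1 : walk_length l u (z :: q) = dist u x by lra.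
have wl2 : walk_length l x p2 = dist x (last x p2) by lra.
have dE : dist u (last x p2) = dist u x + dist x (last x p2) by lra.
have uq1 : uniq (u :: z :: q).
  by apply: (@subseq_uniq _ _ (u :: z :: p)) => //; rewrite pE -!cat_cons prefix_subseq.
have uq2 : uniq (x :: p2).
  have sE : u :: z :: p = (u :: belast z q) ++ (x :: p2).
    by rewrite pE /= -cat_rcons -lastI.
  by move: uq; rewrite sE cat_uniq => /and3P[].
have b1 : dist u x / 12 <= rho y u x := orbit_path_bound uq1 qo' wl1.
have b2 : dist x (last x p2) / 12 <= rho y x (last x p2).
  apply: IH => //; move: ltn; rewrite pE /= size_cat; clear; lia.
suff : rho y u x + rho y x (last x p2) <= rho y u (last x p2) by rewrite dE; lra.
rewrite /rho -big_split; apply: ler_sum => S _ /=.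
have [bS|/y_bond ->] := boolP (bond S); last by rewrite !mul0r addr0.
rewrite -mulrDr ler_wpM2l // (sep_trans S u x (last x p2)).
case s1: (sep S u x); case s2: (sep S x (last x p2)); rewrite /= ?addr0 ?add0r //.
(* Such a bond puts an edge [d3] of the second part on the orbit [o]. The first return to [o] then
   repeats the vertex [x], or contradicts the maximality of the prefix. *)
exfalso.
have [d1' c1' e1'] := walk_cut w1 s1.
have [d1 c1 o1] := cut_edge_orbit (allP qo' _ e1') erefl c1'.
have [d3' c3' e3'] := walk_cut w2 s2.
have [d3 c3 [f3 e3]] := cut_edge_face (allP fp2 _ e3') erefl c3'.
have f1 : froot phi d1 = froot phi f.
  by rewrite -fd; apply: (psi_face_root psi_face); rewrite -(root_connect fsym) o1.
have o3 : froot psi d3 = o by rewrite (bond_one_orbit bS c1 c3) ?f3 ?f1.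
have [q3 [p4 [p2E q3o p4o]]] := walk_split (predC (on_orbit o)) x p2.
case: p4 p2E p4o => [|t p4] p2E p4o.
  rewrite cats0 in p2E; rewrite -p2E in q3o.
  by have /negP[] := allP q3o _ e3'; apply/on_orbitP; exists d3.
rewrite /= negbK in p4o.
have xz : x = last x q3.
  apply: (@no_return f d _ _ q3); first exact: fd.
  - have : on_orbit o (last u (belast z q), x).
      have := last_edge u z q; rewrite -/x.
      by move/(allP qo').
    by case/on_orbit_ends.
  - by case/on_orbit_ends: p4o.
  - by rewrite /walk eqxx andbT; move: pp2; rewrite p2E cat_path => /andP[].
  - by move: fp2; rewrite p2E walk_edges_cat all_cat => /andP[].
  - by [].
case: q3 p2E q3o p4o xz => [|t' q3] p2E q3o p4o xz.
  by move: p2o; rewrite p2E /= p4o.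
move: uq2; rewrite p2E [last _ _]/= in xz * => /andP[+ _]; rewrite xz.
by rewrite mem_cat mem_last.
Qed.

End FacePaths.

(** * Assembling the embedding *)

Lemma shortest_path_uniq (R : realType) (G : sgraph) (l : G -> G -> R) (u : G) (p : seq G) :
  (forall a b : G, adj a b -> 0 < l a b) -> path (@adj G) u p ->
  walk_length l u p = graph_dist l u (last u p) -> uniq (u :: p).
Proof.
move=> l_pos; elim: p u => [|z p IH] u // pp wl.
have [uz pz] : adj u z /\ path (@adj G) z p by apply/andP.
have w2 : walk z (last z p) p by rewrite /walk pz eqxx.
have uqz : uniq (z :: p).
  apply: IH pz _; apply/eqP; rewrite eq_le (dist_le l_pos w2) andbT.
  have r2 : reach z (last z p) by exists p.
  have le := dist_triangle l_pos (reach_adj uz) r2.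
  have := dist_adj l_pos uz.
  by move: wl; rewrite walk_length_cons /=; lra.
(* A return to [u] closes a piece of positive length, and dropping it leaves a shorter walk. *)
rewrite cons_uniq uqz andbT; apply/negP => uin.
case/path.splitP: uin pp wl => p1 p2 pp wl.
have wl' : walk_length l u (rcons p1 u ++ p2) =
    walk_length l u (rcons p1 u) + walk_length l u p2.
  by rewrite walk_length_cat last_rcons.
move: pp; rewrite cat_path last_rcons => /andP[pp1 pp2].
have w : walk u (last u (rcons p1 u ++ p2)) p2.
  by rewrite /walk pp2 last_cat last_rcons eqxx.
have := dist_le l_pos w; rewrite -wl wl' gerDr leNgt => /negP[].
case: p1 pp1 {wl wl' w} => [|a p1] /= /andP[ua pa]; rewrite walk_length_cons.
  by rewrite walk_length_nil addr0 l_pos.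
by apply: ltr_pwDl; [exact: l_pos|exact: walk_length_ge0].
Qed.

Theorem theorem9 (R : realType) (G : sgraph) (M : planar_embedding G)
  (l : G -> G -> R)
  (l_sym : forall u v : G, adj u v -> l u v = l v u)
  (l_pos : forall u v : G, adj u v -> 0 < l u v) :
  exists (k : nat) (g : G -> 'rV[R]_k),
    (forall u v : G, adj u v -> l1_norm (g u - g v) <= graph_dist l u v) /\
    (forall u v : G, geodesic_pair l M u v ->
       graph_dist l u v / 21%:R <= l1_norm (g u - g v)).
Proof.
have [psi [psi_inj psi_src psi_face psi_simple]] := simple_face_walks M.
have [y [y_ge0 y_bond y_edge y_arc]] := geodesic_arcs l_sym l_pos psi_inj psi_src psi_face.
(* One coordinate for each vertex set, so that the norm of a difference is the cut pseudometric
   [rho y]. *)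
exists #|{set G}|, (fun u => \row_i (y (enum_val i) * (u \in enum_val i)%:R)).
have norm_rho u v : l1_norm ((\row_(i < #|{set G}|) (y (enum_val i) * (u \in enum_val i)%:R)) -
    (\row_(i < #|{set G}|) (y (enum_val i) * (v \in enum_val i)%:R))) = rho y u v.
  rewrite /l1_norm /rho [RHS](reindex _ (onW_bij _ (@enum_val_bij {set G}))) /=.
  apply: eq_bigr => i _; rewrite !mxE -mulrBr normrM ger0_norm //; congr (_ * _).
  rewrite /sep; case: (u \in _); case: (v \in _) => /=.
  - by rewrite subrr normr0.
  - by rewrite subr0 normr1.
  - by rewrite sub0r normrN normr1.
  - by rewrite subrr normr0.
split=> u v; rewrite norm_rho.
  by move=> uv; apply: rho_le_dist => //; exact: reach_adj.
case=> f [_ _ [p [/andP[pp /eqP <-] wl] fp]].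
have := face_path_bound l_sym l_pos psi_inj psi_src psi_face psi_simple y_ge0 y_bond y_arc
  (shortest_path_uniq l_pos pp wl) pp fp wl.
(* The bound obtained has 12 in place of 21, and distances are nonnegative. *)
apply: le_trans; rewrite ler_wpM2l ?dist_ge0 //.
by rewrite lef_pV2 ?posrE ?ltr0n // ler_nat.
Qed.
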